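(* Every $A_\infty$-algebra $(\mathcal H,\mathfrak m)$ over $\mathbb C$ is $A_\infty$-isomorphic to the direct sum of a minimal $A_\infty$-algebra and a linear contractible $A_\infty$-algebra.
   Context: Vector spaces are $\mathbb Z$-graded over $\mathbb C$. In exponents of $(-1)$, $o$ denotes the degree of a homogeneous element $o$. An $A_\infty$-algebra $(\mathcal H,\mathfrak m)$ is a graded vector space with degree $+1$ multilinear maps $m_k:\mathcal H^{\otimes k}\to\mathcal H$ $(k\ge1)$ such that for all $n\ge1$ and homogeneous $o_1,\dots,o_n$ $$\sum_{k+l=n+1}\sum_{j=0}^{k-1}(-1)^{o_1+\cdots+o_j}m_k(o_1,\dots,o_j,m_l(o_{j+1},\dots,o_{j+l}),o_{j+l+1},\dots,o_n)=0 .$$ Equivalently, the coderivation $\mathfrak m=\sum_k\mathfrak m_k$ of the tensor coalgebra $C(\mathcal H)=\oplus_{n\ge0}\mathcal H^{\otimes n}$ (deconcatenation coproduct) obtained by lifting the $m_k$ satisfies $\mathfrak m^2=0$. In particular $m_1^2=0$. An $A_\infty$-morphism $\mathcal F=\{f_k\}_{k\ge1}:(\mathcal H,\mathfrak m)\to(\mathcal H',\mathfrak m')$ is a collection of degree $0$ maps $f_k:\mathcal H^{\otimes k}\to\mathcal H'$ such that the induced coalgebra map $\mathcal F:C(\mathcal H)\to C(\mathcal H')$, $\mathcal F(o_1\cdots o_n)=\sum_{1\le k_1<\cdots<k_i=n} f_{k_1}(o_1,\dots,o_{k_1})\otimes\cdots\otimes f_{n-k_{i-1}}(o_{k_{i-1}+1},\dots,o_n)$,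 satisfies $\mathcal F\mathfrak m=\mathfrak m'\mathcal F$. It is an $A_\infty$-isomorphism if $f_1$ is an isomorphism. An $A_\infty$-algebra is minimal if $m_1=0$. It is linear contractible if $m_k=0$ for $k\ge2$ and the cohomology of $m_1$ is zero. The direct sum of two $A_\infty$-algebras is the direct sum of the vector spaces, with each $m_k$ acting componentwise (and vanishing when arguments from both summands occur). *)

(* Defs.v *)
From HB Require Import structures.
From mathcomp Require Import all_boot all_order all_algebra.
From mathcomp Require Import generic_quotient.
From mathcomp Require Import boolp classical_sets cardinality fsbigop reals.
From mathcomp Require Import complex.

Set Implicit Arguments.
Unset Strict Implicit.
Unset Printing Implicit Defensive.

Import Order.TTheory GRing.Theory Num.Theory.
Local Open Scope ring_scope.
Local Open Scope quotient_scope.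

(* A family (phi_k)_k of multilinear maps V^k -> W is encoded as one function
   phi : seq V -> W, where phi_k is the restriction of phi to the words of
   length k. *)
Definition multilinear (K : fieldType) (V W : lmodType K) (phi : seq V -> W) :=
  forall (s1 s2 : seq V) (a : K) (x y : V),
    phi (s1 ++ (a *: x + y) :: s2) =
    a *: phi (s1 ++ x :: s2) + phi (s1 ++ y :: s2).

(* The tensor space C(V) = (+)_(n >= 0) V^(x)n: formal linear combinations of
   words, two of them being identified when all families of multilinear maps
   agree on them. Lemmas tens_multilinear, tlift_linear, tlift_tens and
   tlift_uniq below are its universal property. *)
Section TensorSpace.
Variables (K : fieldType) (V : lmodType K).

Definition teval (W : lmodType K) (phi : seq V -> W) (x : seq (K * seq V)) : W :=
  \sum_(c <- x) c.1 *: phi c.2.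

Definition tequiv (x y : seq (K * seq V)) : bool :=
  `[< forall (W : lmodType K) (phi : seq V -> W),
        multilinear phi -> teval phi x = teval phi y >].

Lemma tequiv_is_equiv : equiv_class_of tequiv.
Proof.
split=> [x|x y|y x z].
- exact/asboolP.
- by apply/asboolP/asboolP => h W phi hphi; rewrite h.
- by move=> /asboolP h1 /asboolP h2; apply/asboolP => W phi hphi; rewrite h1 ?h2.
Qed.

Canonical tequiv_equiv := EquivRelPack tequiv_is_equiv.
Canonical tequiv_encModRel := defaultEncModRel tequiv.

Definition tensor := {eq_quot tequiv}.
HB.instance Definition _ : EqQuotient _ tequiv tensor := EqQuotient.on tensor.
HB.instance Definition _ := Choice.on tensor.

Definition tens (w : seq V) : tensor := \pi_tensor [:: (1, w)].

Definition tlift (W : lmodType K) (phi : seq V -> W) (x : tensor) : W :=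
  teval phi (repr x).

Definition fscale (a : K) (x : seq (K * seq V)) := [seq (a * c.1, c.2) | c <- x].

Definition tzero : tensor := \pi_tensor [::].
Definition tadd (x y : tensor) : tensor := \pi_tensor (repr x ++ repr y).
Definition tscale (a : K) (x : tensor) : tensor := \pi_tensor (fscale a (repr x)).
Definition topp (x : tensor) : tensor := tscale (-1) x.

Lemma tpiP x y : reflect
  (forall (W : lmodType K) (phi : seq V -> W),
     multilinear phi -> teval phi x = teval phi y)
  (\pi_tensor x == \pi_tensor y).
Proof. by rewrite eqmodE; apply: (iffP (asboolP _)). Qed.

Lemma teval_repr (W : lmodType K) (phi : seq V -> W) x :
  multilinear phi -> teval phi (repr (\pi_tensor x)) = teval phi x.
Proof. by move=> h; have /eqP/tpiP := reprK (\pi_tensor x); apply. Qed.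

Lemma teval_cat (W : lmodType K) (phi : seq V -> W) x y :
  teval phi (x ++ y) = teval phi x + teval phi y.
Proof. exact: big_cat. Qed.

Lemma teval_scale (W : lmodType K) (phi : seq V -> W) a x :
  teval phi (fscale a x) = a *: teval phi x.
Proof.
by rewrite /teval big_map scaler_sumr; apply: eq_bigr => c _; rewrite scalerA.
Qed.

Lemma tensP (x y : tensor) : (forall (W : lmodType K) (phi : seq V -> W),
  multilinear phi -> tlift phi x = tlift phi y) -> x = y.
Proof. by move=> h; rewrite -[x]reprK -[y]reprK; apply/eqP/tpiP. Qed.

Lemma tlift_add (W : lmodType K) (phi : seq V -> W) x y : multilinear phi ->
  tlift phi (tadd x y) = tlift phi x + tlift phi y.
Proof. by move=> h; rewrite /tlift teval_repr // teval_cat. Qed.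

Lemma tlift_scale (W : lmodType K) (phi : seq V -> W) a x : multilinear phi ->
  tlift phi (tscale a x) = a *: tlift phi x.
Proof. by move=> h; rewrite /tlift teval_repr // teval_scale. Qed.

Lemma tlift_zero (W : lmodType K) (phi : seq V -> W) : multilinear phi ->
  tlift phi tzero = 0.
Proof. by move=> h; rewrite /tlift teval_repr // /teval big_nil. Qed.

Lemma taddA : associative tadd.
Proof. by move=> x y z; apply: tensP => W phi h; rewrite !tlift_add // addrA. Qed.
Lemma taddC : commutative tadd.
Proof. by move=> x y; apply: tensP => W phi h; rewrite !tlift_add // addrC. Qed.
Lemma tadd0 : left_id tzero tadd.
Proof.
by move=> x; apply: tensP => W phi h; rewrite tlift_add // tlift_zero // add0r.
Qed.
Lemma taddN : left_inverse tzero topp tadd.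
Proof.
move=> x; apply: tensP => W phi h.
by rewrite tlift_add // tlift_zero // tlift_scale // scaleN1r addNr.
Qed.
HB.instance Definition _ := GRing.isZmodule.Build tensor taddA taddC tadd0 taddN.

Lemma tscaleA a b x : tscale a (tscale b x) = tscale (a * b) x.
Proof. by apply: tensP => W phi h; rewrite !tlift_scale // scalerA. Qed.
Lemma tscale1 : left_id 1 tscale.
Proof. by move=> x; apply: tensP => W phi h; rewrite tlift_scale // scale1r. Qed.
Lemma tscaleDr : right_distributive tscale +%R.
Proof.
move=> a x y; apply: tensP => W phi h.
by rewrite !(tlift_scale, tlift_add) // scalerDr.
Qed.
Lemma tscaleDl x : {morph tscale^~ x : a b / a + b}.
Proof.
move=> a b; apply: tensP => W phi h.
by rewrite !(tlift_scale, tlift_add) // scalerDl.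
Qed.
HB.instance Definition _ := GRing.Zmodule_isLmodule.Build K tensor
  tscaleA tscale1 tscaleDr tscaleDl.

Lemma tlift_linear (W : lmodType K) (phi : seq V -> W) :
  multilinear phi -> linear (tlift phi).
Proof. by move=> h a x y; rewrite tlift_add // tlift_scale. Qed.

Lemma tlift_tens (W : lmodType K) (phi : seq V -> W) w :
  multilinear phi -> tlift phi (tens w) = phi w.
Proof.
by move=> h; rewrite /tlift teval_repr // /teval big_seq1 /= scale1r.
Qed.

Lemma tens_multilinear : multilinear tens.
Proof.
move=> s1 s2 a x y; apply: tensP => W phi h.
by rewrite tlift_linear // !tlift_tens.
Qed.

Lemma tensor_span (x : tensor) : x = \sum_(c <- repr x) c.1 *: tens c.2.
Proof.
apply: tensP => W phi h; rewrite {1}/tlift /teval.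
elim: (repr x) => [|c s ih]; first by rewrite !big_nil tlift_zero.
by rewrite !big_cons tlift_linear // -ih tlift_tens.
Qed.

Lemma tlift_uniq (W : lmodType K) (phi : seq V -> W) (g : tensor -> W) :
  linear g -> (forall w, g (tens w) = phi w) -> g =1 tlift phi.
Proof.
move=> gL gE x; rewrite {1}[x]tensor_span /tlift /teval.
have g0 : g 0 = 0 by have := gL (-1) 0 0; rewrite scaler0 addr0 scaleN1r addNr.
elim: (repr x) => [|c s ih]; first by rewrite !big_nil.
by rewrite !big_cons gL gE ih.
Qed.

End TensorSpace.

(* A Z-grading of a vector space, given by the projections gpr d onto the
   components of degree d. *)
Record gspace (K : fieldType) := GSpace {
  gcarrier :> lmodType K;
  gpr : int -> {linear gcarrier -> gcarrier};
  gpr_id : forall d v, gpr d (gpr d v) = gpr d v;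
  gpr_orth : forall d e v, d != e -> gpr d (gpr e v) = 0;
  gpr_sum : forall v, exists2 s : seq int, uniq s & v = \sum_(d <- s) gpr d v
}.

Definition homog (K : fieldType) (H : gspace K) (d : int) : pred H :=
  fun v => gpr H d v == v.

(* The parity operator: o |-> (-1)^(deg o) o on homogeneous elements. *)
Definition parity (K : fieldType) (H : gspace K) (v : H) : H :=
  \sum_(d \in [set: int]) ((-1 : K) ^ d) *: gpr H d v.

Lemma fsbig_seq_supp (W : zmodType) (F : int -> W) (s : seq int) : uniq s ->
  (forall d, d \notin s -> F d = 0) ->
  \sum_(d \in [set: int]) F d = \sum_(d <- s) F d.
Proof.
move=> us h; rewrite fsbig_supp; apply: fsbig_fwiden => //.
  move=> d [_ /= Fd]; apply: contrapT => /negP ds; exact/Fd/h.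
by move=> d [_ /not_andP[] //= Fd]; apply: contrapT => ?; apply: Fd.
Qed.

Section Parity.
Variables (K : fieldType) (H : gspace K).

Lemma parityE (s : seq int) (v : H) : uniq s ->
  (forall d, d \notin s -> gpr H d v = 0) ->
  parity v = \sum_(d <- s) ((-1 : K) ^ d) *: gpr H d v.
Proof.
by move=> us h; apply: fsbig_seq_supp => // d ds; rewrite h // scaler0.
Qed.

Lemma gpr_supp (v : H) : exists2 s : seq int, uniq s &
  forall d, d \notin s -> gpr H d v = 0.
Proof.
have [s us ->] := gpr_sum v; exists s => // d ds.
rewrite linear_sum big1_seq //= => e es; rewrite gpr_orth //.
by apply/eqP => de; rewrite de es in ds.
Qed.

Lemma gpr_sum_supp (s : seq int) (v : H) : uniq s ->
  (forall d, d \notin s -> gpr H d v = 0) -> v = \sum_(d <- s) gpr H d v.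
Proof.
move=> us hs; have [r ur rE] := gpr_sum v.
rewrite -fsbig_seq_supp // (@fsbig_seq_supp _ _ r) // => d dr; rewrite rE linear_sum big1_seq //= => e er.
by rewrite gpr_orth //; apply/eqP => de; rewrite de er in dr.
Qed.

Lemma parity_linear : linear (@parity K H).
Proof.
move=> a x y.
have [s us hs] := gpr_supp x; have [t ut ht] := gpr_supp y.
pose r := undup (s ++ t).
have hr d : d \notin r -> gpr H d x = 0 /\ gpr H d y = 0.
  rewrite mem_undup mem_cat negb_or => /andP[ds dt].
  by split; [exact: hs | exact: ht].
rewrite !(@parityE r) ?undup_uniq // => [|d /hr[]//|d /hr[]//|d /hr[ex ey]].
  rewrite scaler_sumr -big_split; apply: eq_bigr => d _.
  by rewrite linearP scalerDr !scalerA mulrC.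
by rewrite linearP ex ey scaler0 addr0.
Qed.

Lemma parity_homog d (v : H) : homog d v -> parity v = ((-1 : K) ^ d) *: v.
Proof.
move=> /eqP hv; rewrite (@parityE [:: d]) ?big_seq1 ?hv //.
by move=> e; rewrite inE => ed; rewrite -hv gpr_orth.
Qed.

End Parity.

(* All ways of cutting a word into consecutive nonempty blocks. *)
Fixpoint splits (T : Type) (s : seq T) : seq (seq (seq T)) :=
  if s is x :: s' then
    flatten [seq (if p is b :: p' then [:: (x :: b) :: p'; [:: x] :: p]
                  else [:: [:: [:: x]]]) | p <- splits s']
  else [:: [::]].

Lemma mem_splits (T : eqType) (s : seq T) (p : seq (seq T)) :
  (p \in splits s) = (flatten p == s) && all (fun b => b != [::]) p.
Proof.
elim: s p => [|x s ih] p /=.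
  by rewrite inE; case: p => [|[|a b] p] //=; rewrite andbF.
apply/flatten_mapP/idP => [[q]|].
  rewrite ih => /andP[/eqP fq aq]; case: q fq aq => [|b q] /= fq aq.
    by rewrite inE => /eqP->; rewrite -fq /= eqxx.
  by rewrite !inE => /orP[/eqP->|/eqP->] /=; rewrite ?fq eqxx //=; case/andP: aq.
case: p => [|[|y [|z b]] p] //=; rewrite ?andbF // eqseq_cons => /andP[/andP[/eqP-> fp] ap].
  exists p; first by rewrite ih fp.
  by case: p {fp ap} => [|c p]; rewrite !inE eqxx ?orbT.
by exists ((z :: b) :: p); rewrite ?ih /= ?fp // !inE eqxx.
Qed.

Lemma uniq_splits (T : eqType) (s : seq T) : uniq (splits s).
Proof.
elim: s => [|x s ih] //=.
have: all (fun p : seq (seq T) => all (fun b => b != [::]) p) (splits s).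
  by apply/allP => p; rewrite mem_splits => /andP[].
pose inv (q : seq (seq T)) : seq (seq T) :=
  if q is (_ :: (y :: b)) :: p then (y :: b) :: p else behead q.
elim: (splits s) ih => [|p L ihL] //= /andP[pL uL] /andP[ap aL].
rewrite cat_uniq ihL // andbT; apply/andP; split.
  case: p ap {pL} => [|[|y b] p] //= _.
  by rewrite inE andbT eqseq_cons eqseq_cons /= andbF.
apply/hasPn => q /flatten_mapP[r rL qr]; apply: contra pL => qp.
have iE t : all (fun b => b != [::]) t -> q \in (if t is b :: p' then
    [:: (x :: b) :: p'; [:: x] :: t] else [:: [:: [:: x]]]) -> inv q = t.
  case: t => [|[|y b] t] //= _; first by rewrite inE => /eqP->.
  by rewrite !inE => /orP[]/eqP->.
by rewrite -(iE p ap qp) (iE r (allP aL r rL) qr).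
Qed.

Lemma splits_context (T : Type) (s1 s2 : seq T) :
  exists L : seq (seq (seq T) * seq T * seq T * seq (seq T)), forall z,
    splits (s1 ++ z :: s2) =
    [seq c.1.1.1 ++ (c.1.1.2 ++ z :: c.1.2) :: c.2 | c <- L].
Proof.
elim: s1 => [|x s1 [L hL]] /=.
  exists (flatten [seq (if p is b :: p' then
      [:: ([::], [::], b, p'); ([::], [::], [::], p)]
      else [:: ([::], [::], [::], [::])]) | p <- splits s2]) => z.
  rewrite map_flatten -map_comp; congr flatten.
  by apply: eq_map => -[|b p].
exists (flatten [seq (if c.1.1.1 is b :: p' then
      [:: ((x :: b) :: p', c.1.1.2, c.1.2, c.2);
          ([:: x] :: c.1.1.1, c.1.1.2, c.1.2, c.2)]
      else [:: ([::], x :: c.1.1.2, c.1.2, c.2);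
               ([:: [:: x]], c.1.1.2, c.1.2, c.2)]) | c <- L]) => z.
rewrite hL map_flatten -!map_comp; congr flatten.
by apply: eq_map => -[[[[|b p] b1] b2] p2].
Qed.

(* The coderivation of C(H) lifting m = (m_k)_(k >= 1):
     o_1...o_n |-> sum (-1)^(o_1+...+o_j) o_1...o_j m_l(o_(j+1),...) ... o_n. *)
Definition coder_word (K : fieldType) (H : gspace K) (m : seq H -> H)
    (w : seq H) : tensor H :=
  let n := size w in
  \sum_(1 <= k < n.+1) \sum_(0 <= j < k)
    let l := (n.+1 - k)%N in
    tens (map (@parity K H) (take j w)
            ++ m (take l (drop j w)) :: drop (j + l) w).

Definition coder (K : fieldType) (H : gspace K) (m : seq H -> H) :
    tensor H -> tensor H :=
  tlift (coder_word m).

(* The coalgebra map C(H) -> C(H') induced by f = (f_k)_(k >= 1). *)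
Definition comor_word (K : fieldType) (H H' : gspace K) (f : seq H -> H')
    (w : seq H) : tensor H' :=
  \sum_(p <- splits w) tens (map f p).

Definition comor (K : fieldType) (H H' : gspace K) (f : seq H -> H') :
    tensor H -> tensor H' :=
  tlift (comor_word f).

Section CoderComor.
Variables (K : fieldType) (H H' : gspace K).

Lemma coder_word_multilinear (m : seq H -> H) :
  multilinear m -> multilinear (coder_word m).
Proof.
move=> mL s1 s2 a x y; rewrite /coder_word !size_cat /=.
rewrite scaler_sumr -big_split; apply: eq_bigr => k _.
rewrite scaler_sumr -big_split; apply: eq_bigr => j _ /=.
move: (_ - k)%N => l.
have tensE (p : seq H) q : tens (p ++ q :: (a *: x + y) :: s2) =
    a *: tens (p ++ q :: x :: s2) + tens (p ++ q :: y :: s2).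
  by rewrite -!(cat_rcons q) tens_multilinear.
rewrite !take_cat !drop_cat; case: ltnP => js.
  rewrite !take_cat !size_drop; case: ltnP => ls.
    have ->: (j + l < size s1)%N by rewrite -ltn_subRL.
    by rewrite -!cat_cons !catA; exact: tens_multilinear.
  have ->: (j + l < size s1)%N = false.
    by apply/negbTE; rewrite -leqNgt -leq_subLR.
  rewrite subnBA ?(ltnW js) // (addnC l j).
  case: (j + l - size s1)%N => [|i] /=.
    by rewrite !cats0 tensE.
  by rewrite mL tens_multilinear.
have ->: (j + l < size s1)%N = false.
  by apply/negbTE; rewrite -leqNgt (leq_trans js) // leq_addr.
rewrite addnC -addnBA //.
case: (j - size s1)%N => [|i] /=.
  rewrite addn0 !cats0; case: l => [|l] /=.
    exact: tensE.
  by rewrite (mL [::]) tens_multilinear.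
rewrite addnS /= !map_cat /= parity_linear -!catA /=.
exact: tens_multilinear.
Qed.

Lemma comor_word_multilinear (f : seq H -> H') :
  multilinear f -> multilinear (comor_word f).
Proof.
move=> fL s1 s2 a x y; rewrite /comor_word.
have [L hL] := splits_context s1 s2; rewrite !hL !big_map.
rewrite scaler_sumr -big_split; apply: eq_bigr => c _ /=.
by rewrite !map_cat /= fL tens_multilinear.
Qed.

Lemma coder_tens (m : seq H -> H) w :
  multilinear m -> coder m (tens w) = coder_word m w.
Proof. by move=> /coder_word_multilinear h; exact: tlift_tens. Qed.

Lemma tens_parity (ds : seq int) (p w s : seq H) : all2 (@homog K H) ds w ->
  tens (p ++ map (@parity K H) w ++ s) =
  ((-1 : K) ^ (\sum_(d <- ds) d)) *: tens (p ++ w ++ s).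
Proof.
elim: ds w p => [|d ds ih] [|v w] p //=; first by rewrite big_nil scale1r.
case/andP => /parity_homog-> dw.
have tens0 s1 s2 : tens (s1 ++ (0 : H) :: s2) = 0.
  have := tens_multilinear s1 s2 (-1) 0 0.
  by rewrite scaler0 addr0 scaleN1r addNr.
have -> a r : tens (p ++ (a *: v) :: r) = a *: tens (p ++ v :: r).
  by have := tens_multilinear p r a v 0; rewrite tens0 !addr0.
rewrite big_cons expfzDr ?oppr_eq0 ?oner_eq0 // -scalerA; congr (_ *: _).
by rewrite -!(cat_rcons v) ih.
Qed.

Lemma coder_homog (m : seq H -> H) (ds : seq int) (w : seq H) :
  multilinear m -> all2 (@homog K H) ds w ->
  let n := size w in
  coder m (tens w) =
  \sum_(1 <= k < n.+1) \sum_(0 <= j < k)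
    (let l := (n.+1 - k)%N in
     ((-1 : K) ^ (\sum_(d <- take j ds) d)) *:
       tens (take j w ++ m (take l (drop j w)) :: drop (j + l) w)).
Proof.
move=> mL dw /=; rewrite coder_tens //.
apply: eq_bigr => k _; apply: eq_bigr => j _.
apply: (tens_parity [::]); elim: ds w j dw => [|d ds ih] [|v w] [|j] //=.
by move=> /andP[-> /ih]; apply.
Qed.

Lemma comor_tens (f : seq H -> H') w :
  multilinear f -> comor f (tens w) = comor_word f w.
Proof. by move=> /comor_word_multilinear h; exact: tlift_tens. Qed.

End CoderComor.

Definition ainf_relations (K : fieldType) (H : gspace K) (m : seq H -> H) :=
  forall (ds : seq int) (w : seq H), all2 (@homog K H) ds w ->
    let n := size w in
    \sum_(1 <= k < n.+1) \sum_(0 <= j < k)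
      (let l := (n.+1 - k)%N in
       ((-1 : K) ^ (\sum_(d <- take j ds) d)) *:
         m (take j w ++ m (take l (drop j w)) :: drop (j + l) w)) = 0.

(* phi_k has degree e for every k >= 1 *)
Definition has_degree (K : fieldType) (H H' : gspace K) (e : int)
    (phi : seq H -> H') :=
  forall (ds : seq int) (w : seq H), w != [::] -> all2 (@homog K H) ds w ->
    homog (\sum_(d <- ds) d + e) (phi w).

(* m_k is aop on words of length k; the value of aop on the empty word is
   irrelevant, as there is no m_0. *)
Record ainf_algebra (K : fieldType) := AInfAlgebra {
  aspace :> gspace K;
  aop : seq aspace -> aspace;
  aop_multilinear : multilinear aop;
  aop_degree : has_degree 1 aop;
  aop_relations : ainf_relations aop
}.

Definition is_ainf_morphism (K : fieldType) (A B : ainf_algebra K)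
    (f : seq A -> B) :=
  [/\ multilinear f, has_degree 0 f &
      comor f \o coder (@aop K A) =1 coder (@aop K B) \o comor f].

Definition is_ainf_isomorphism (K : fieldType) (A B : ainf_algebra K)
    (f : seq A -> B) :=
  is_ainf_morphism f /\ bijective (fun x : A => f [:: x]).

Definition ainf_isomorphic (K : fieldType) (A B : ainf_algebra K) :=
  exists f : seq A -> B, is_ainf_isomorphism f.

Definition minimal (K : fieldType) (A : ainf_algebra K) :=
  forall x : A, aop [:: x] = 0.

Definition linear_contractible (K : fieldType) (A : ainf_algebra K) :=
  (forall w : seq A, (2 <= size w)%N -> aop w = 0) /\
  (forall x : A, aop [:: x] = 0 -> exists y : A, aop [:: y] = x).

Section DirectSum.
Variables (K : fieldType).

Section Graded.
Variables (H H' : gspace K).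

Definition dsum_pr (d : int) (v : H * H') : H * H' :=
  (gpr H d v.1, gpr H' d v.2).

Lemma dsum_pr_linear d : linear (dsum_pr d).
Proof. by move=> a x y; rewrite /dsum_pr /= !linearP. Qed.

HB.instance Definition _ d :=
  GRing.isLinear.Build K (H * H')%type (H * H')%type _ (dsum_pr d)
    (dsum_pr_linear d).

Lemma dsum_pr_id d v : dsum_pr d (dsum_pr d v) = dsum_pr d v.
Proof. by rewrite /dsum_pr /= !gpr_id. Qed.

Lemma dsum_pr_orth d e v : d != e -> dsum_pr d (dsum_pr e v) = 0.
Proof. by move=> de; rewrite /dsum_pr /= !gpr_orth. Qed.

Lemma dsum_pr_sum v :
  exists2 s : seq int, uniq s & v = \sum_(d <- s) dsum_pr d v.
Proof.
have [s us hs] := gpr_supp v.1; have [t ut ht] := gpr_supp v.2.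
exists (undup (s ++ t)); first exact: undup_uniq.
have pE (r : seq int) : \sum_(d <- r) dsum_pr d v =
    (\sum_(d <- r) gpr H d v.1, \sum_(d <- r) gpr H' d v.2).
  by elim: r => [|d r ih]; rewrite ?big_nil // !big_cons ih.
rewrite pE -!gpr_sum_supp ?undup_uniq //; first by case: (v).
- by move=> d; rewrite mem_undup mem_cat negb_or => /andP[_ /ht].
- by move=> d; rewrite mem_undup mem_cat negb_or => /andP[/hs].
Qed.

Definition dsum_gspace : gspace K :=
  @GSpace K (H * H')%type dsum_pr dsum_pr_id dsum_pr_orth dsum_pr_sum.

Lemma dsum_homog d (v : dsum_gspace) :
  homog d v = homog d v.1 && homog d v.2.
Proof. by []. Qed.

Lemma dsum_all2_homog ds (w : seq dsum_gspace) :
  all2 (@homog K dsum_gspace) ds w ->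
  all2 (@homog K H) ds (map fst w) /\ all2 (@homog K H') ds (map snd w).
Proof.
elim: ds w => [|d ds ih] [|v w] //= /andP[].
by rewrite dsum_homog => /andP[-> ->] /ih[].
Qed.

End Graded.

Section Algebra.
Variables (A B : ainf_algebra K).

Definition dsum_op (w : seq (dsum_gspace A B)) : dsum_gspace A B :=
  (aop (map fst w), aop (map snd w)).

Lemma dsum_op_multilinear : multilinear dsum_op.
Proof.
by move=> s1 s2 a x y; rewrite /dsum_op !map_cat /= !aop_multilinear.
Qed.

Lemma dsum_op_degree : has_degree 1 dsum_op.
Proof.
move=> ds w w0 /dsum_all2_homog[h1 h2]; rewrite dsum_homog.
by apply/andP; split; apply: aop_degree => //; case: (w) w0.
Qed.

Lemma dsum_op_relations : ainf_relations dsum_op.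
Proof.
move=> ds w /dsum_all2_homog[/aop_relations hA /aop_relations hB] /=.
have sumE (I : Type) (r : seq I) (F : I -> dsum_gspace A B) :
    \sum_(i <- r) F i = (\sum_(i <- r) (F i).1, \sum_(i <- r) (F i).2).
  by elim: r => [|i r ih]; rewrite ?big_nil // !big_cons ih.
rewrite sumE; congr pair; [rewrite -[RHS]hA | rewrite -[RHS]hB];
  rewrite size_map; apply: eq_bigr => k _; rewrite sumE /=;
  by apply: eq_bigr => j _; rewrite map_cat /= !map_take !map_drop.
Qed.

Definition dsum : ainf_algebra K :=
  AInfAlgebra dsum_op_multilinear dsum_op_degree dsum_op_relations.

End Algebra.
End DirectSum.

(* Main.v *)
From HB Require Import structures.
Require Import Defs.
From mathcomp Require Import all_boot all_order all_algebra.
From mathcomp Require Import boolp classical_sets fsbigop.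

From mathcomp Require Import reals complex.
From mathcomp Require Import zify.

(** Let d be the linear part of the operations m. Over a field the complex splits:
    there are a homotopy h and a projection P, homogeneous of degrees -1 and 0,
    with d h + h d = 1 - P and P d = d P = 0 ([contraction_exists], which rests
    on the existence of complements of subspaces). The image of P represents
    the cohomology, and d restricted to the image of 1 - P is acyclic.

    One looks for operations m' with the same linear part d, whose components
    of arity at least two take values in the image of P and depend only on the
    images of their arguments under P, together with a morphism f from m to m'
    with the identity as linear part. Such m' are the direct sum of a minimal
    structure on the image of P and of the linear contractible d on the image
    of 1 - P ([retract_algebra], [ainf_decomposition]).

    The components of f and m' are built by induction on the arity
    ([transfer_exists]). If f is a morphism up to arity n, its defect U in arity
    n+1 satisfies delta U = - O, where delta is the differential of
    Hom(H^(n+1), H) and O is the square of m' in that arity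
    ([defect_boundary]). Since the compositions in O involve only components of
    arity at least two, O is its own part between images of P, whereas this
    part of the boundary delta U is zero; hence O = 0 and U is a cocycle
    ([U_closed]). The homotopy h induces one on tensor powers
    ([ins_homotopy]) and then on Hom(H^(n+1), H), so U differs from P U P by the
    boundary of h U - P U h. These are the next components of m' and of f
    ([step_cancel]).

    Identities between coalgebra maps and coderivations are read on cochains,
    i.e. on families of multilinear maps on words, through the transposes
    [dpull] and [fpull]. Their combinatorics reduces to sums over the ways of
    cutting a word, with coassociativity ([cutsA]) as the basic rule. The two
    identities on which the argument rests are the formula for the square of a
    coderivation ([dpull_dpull]) and the fact that a coalgebra map intertwines
    two coderivations up to its defect ([dpull_fpull_defect]). Signs are carried
    by the parity operator, so that no homogeneous elements have to be
    chosen. *)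

Set Implicit Arguments.
Unset Strict Implicit.
Unset Printing Implicit Defensive.

Import Order.TTheory GRing.Theory Num.Theory.
Local Open Scope ring_scope.

(** * Deconcatenation of words *)

Fixpoint cuts (T : Type) (w : seq T) : seq (seq T * seq T) :=
  ([::], w) ::
  (if w is x :: w' then [seq (x :: c.1, c.2) | c <- cuts w'] else [::]).

Section Cuts.
Variable T : Type.
Implicit Types (x y : T) (s t w : seq T).

Lemma cuts_take_drop w :
  cuts w = [seq (take i w, drop i w) | i <- iota 0 (size w).+1].
Proof.
elim: w => [|x w ih] //.
have -> : iota 0 (size (x :: w)).+1 = 0%N :: map succn (iota 0 (size w).+1).
  by rewrite -(iotaDl 1 0).
by rewrite map_cons -map_comp /= ih -map_comp.
Qed.

Lemma cuts_map (U : Type) (g : T -> U) w :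
  cuts (map g w) = [seq (map g c.1, map g c.2) | c <- cuts w].
Proof. by elim: w => [|x w ih] //=; rewrite ih -!map_comp. Qed.

Lemma cuts_mid s y t :
  cuts (s ++ y :: t) =
  [seq (c.1, c.2 ++ y :: t) | c <- cuts s] ++
  [seq (s ++ y :: c.1, c.2) | c <- cuts t].
Proof. by elim: s => [|x s ih] //=; rewrite ih map_cat -!map_comp. Qed.

Variable W : zmodType.

Lemma big_cuts_cons x w (g : seq T -> seq T -> W) :
  \sum_(c <- cuts (x :: w)) g c.1 c.2 =
  g [::] (x :: w) + \sum_(c <- cuts w) g (x :: c.1) c.2.
Proof. by rewrite /= big_cons big_map. Qed.

Lemma eq_cuts w (F G : seq T -> seq T -> W) :
  (forall a b, size w = (size a + size b)%N -> F a b = G a b) ->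
  \sum_(c <- cuts w) F c.1 c.2 = \sum_(c <- cuts w) G c.1 c.2.
Proof.
elim: w F G => [|x w ih] F G h; first by rewrite /= !big_seq1 h.
rewrite !big_cuts_cons h //; congr (_ + _).
by apply: (ih (fun a => F (x :: a)) (fun a => G (x :: a))) => a b e; rewrite h //= e.
Qed.

(** Coassociativity of deconcatenation. *)
Lemma cutsA w (g : seq T -> seq T -> seq T -> W) :
  \sum_(c <- cuts w) \sum_(d <- cuts c.1) g d.1 d.2 c.2 =
  \sum_(c <- cuts w) \sum_(d <- cuts c.2) g c.1 d.1 d.2.
Proof.
elim: w g => [|x w ih] g; first by rewrite /= !big_seq1.
rewrite (big_cuts_cons x w (fun a b => \sum_(d <- cuts a) g d.1 d.2 b)).
rewrite (big_cuts_cons x w (fun a b => \sum_(d <- cuts b) g a d.1 d.2)).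
rewrite (big_cuts_cons x w (g [::])) /= big_seq1 -addrA; congr (_ + _).
rewrite -(ih (fun a => g (x :: a))) -big_split /=; apply: eq_bigr => c _.
by rewrite big_cons big_map.
Qed.

(** The sum is organized by the first block, which is not empty. *)
Lemma big_splits_cons x w (g : seq (seq T) -> W) :
  \sum_(p <- splits (x :: w)) g p =
  \sum_(c <- cuts w) \sum_(p <- splits c.2) g ((x :: c.1) :: p).
Proof.
elim: w x g => [|y w ih] x g; first by rewrite /= !(big_cons, big_nil) /= !addr0.
pose G (p : seq (seq T)) := if p is b :: p' then g ((x :: b) :: p') else 0.
have nilS : all (fun p => ~~ nilp p) (splits (y :: w)).
  by rewrite /=; elim: (splits w) => //= -[|b q] L ihL.
have -> : \sum_(p <- splits (x :: y :: w)) g p =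
    \sum_(p <- splits (y :: w)) (G p + g ([:: x] :: p)).
  rewrite [splits (x :: _)]/= -/(splits (y :: w)); move: nilS.
  elim: (splits (y :: w)) => [|p L ihL] nilS; first by rewrite /= !big_nil.
  case/andP: nilS => pN /ihL {}ihL; rewrite [flatten _]/= big_cat big_cons ihL.
  case: p pN => [|b p] //= _.
  by rewrite !(big_cons, big_nil) addr0.
rewrite big_split /= addrC big_cons big_map /=; congr (_ + _).
exact: (ih y G).
Qed.

(** The sum is organized by the block that contains the letter [y]. *)
Lemma big_splits_mid s y t (g : seq (seq T) -> W) :
  \sum_(p <- splits (s ++ y :: t)) g p =
  \sum_(c <- cuts s) \sum_(d <- cuts t)
    \sum_(p <- splits c.1) \sum_(q <- splits d.2)
      g (p ++ (c.2 ++ y :: d.1) :: q).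
Proof.
have [n] := ubnP (size s); elim: n s g => // n ih [|x s] g /= sn.
  rewrite big_seq1 /= big_splits_cons; apply: eq_bigr => d _.
  by rewrite big_seq1.
rewrite -/(splits (x :: _)) big_splits_cons cuts_mid big_cat !big_map /=.
rewrite big_cons big_map /= addrC; congr (_ + _).
  by apply: eq_bigr => d _; rewrite big_seq1.
rewrite (@eq_cuts s (fun a b => \sum_(p <- splits (b ++ y :: t)) g ((x :: a) :: p))
  (fun a b => \sum_(e <- cuts b) \sum_(d <- cuts t) \sum_(p <- splits e.1)
     \sum_(q <- splits d.2) g ((x :: a) :: p ++ (e.2 ++ y :: d.1) :: q))); last first.
  move=> a b sab; apply: (ih b (fun p => g ((x :: a) :: p))).
  by move: sn; rewrite ltnS sab; apply: leq_ltn_trans; rewrite leq_addl.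
rewrite -(cutsA s (fun a b c => \sum_(d <- cuts t) \sum_(p <- splits b)
  \sum_(q <- splits d.2) g ((x :: a) :: p ++ (c ++ y :: d.1) :: q))).
apply: eq_bigr => c _; rewrite exchange_big; apply: eq_bigr => d _ /=.
rewrite -/(splits (x :: _)) big_splits_cons; apply: eq_bigr => e _.
by [].
Qed.

(** Compatibility of the coalgebra maps with deconcatenation. *)
Lemma big_splits_cuts w (g : seq (seq T) -> seq (seq T) -> W) :
  \sum_(p <- splits w) \sum_(c <- cuts p) g c.1 c.2 =
  \sum_(c <- cuts w) \sum_(p <- splits c.1) \sum_(q <- splits c.2) g p q.
Proof.
have [n] := ubnP (size w); elim: n w g => // n ih [|x w] g sn.
  by rewrite /= !big_seq1.
rewrite (big_cuts_cons x w (fun a b => \sum_(p <- splits a) \sum_(q <- splits b) g p q)).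
rewrite [splits [::]]/= big_seq1 !big_splits_cons.
transitivity (\sum_(c <- cuts w) \sum_(p <- splits c.2) g [::] ((x :: c.1) :: p) +
  \sum_(c <- cuts w) \sum_(p <- splits c.2) \sum_(d <- cuts p)
     g ((x :: c.1) :: d.1) d.2).
  rewrite -big_split; apply: eq_bigr => c _; rewrite -big_split.
  by apply: eq_bigr => p _; rewrite /= big_cons big_map.
congr (_ + _).
rewrite (@eq_cuts w (fun a b => \sum_(p <- splits b) \sum_(d <- cuts p)
     g ((x :: a) :: d.1) d.2) (fun a b => \sum_(e <- cuts b)
   \sum_(p <- splits e.1) \sum_(q <- splits e.2) g ((x :: a) :: p) q)); last first.
  move=> a b wab; apply: (ih b (fun p => g ((x :: a) :: p))).
  by move: sn; rewrite /= ltnS wab; apply: leq_ltn_trans; rewrite leq_addl.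
rewrite -(cutsA w (fun a b c =>
   \sum_(p <- splits b) \sum_(q <- splits c) g ((x :: a) :: p) q)).
by apply: eq_bigr => c _; rewrite big_splits_cons.
Qed.

Lemma splits_map (U : Type) (g : T -> U) w :
  splits (map g w) = [seq map (map g) p | p <- splits w].
Proof.
elim: w => [|x w ih] //=; rewrite ih map_flatten -!map_comp; congr flatten.
by apply: eq_map => -[|b p].
Qed.

End Cuts.

(** * Cochains and their pullbacks *)

Section Multilinear.
Variables (K : fieldType) (V W : lmodType K) (phi : seq V -> W).
Hypothesis phiL : multilinear phi.

Lemma mlin0 s t : phi (s ++ 0 :: t) = 0.
Proof.
have := phiL s t (-1) 0 0.
by rewrite scaler0 addr0 scaleN1r addNr.
Qed.

Lemma mlinD s t x y : phi (s ++ (x + y) :: t) = phi (s ++ x :: t) + phi (s ++ y :: t).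
Proof. by have := phiL s t 1 x y; rewrite !scale1r. Qed.

Lemma mlinZ s t a x : phi (s ++ (a *: x) :: t) = a *: phi (s ++ x :: t).
Proof. by have := phiL s t a x 0; rewrite !addr0 mlin0 addr0. Qed.

Lemma mlinN s t x : phi (s ++ (- x) :: t) = - phi (s ++ x :: t).
Proof. by rewrite -scaleN1r mlinZ scaleN1r. Qed.

Lemma mlin_sum (I : Type) (r : seq I) (F : I -> V) s t :
  phi (s ++ (\sum_(i <- r) F i) :: t) = \sum_(i <- r) phi (s ++ F i :: t).
Proof.
elim: r => [|i r ih]; first by rewrite !big_nil mlin0.
by rewrite !big_cons mlinD ih.
Qed.

Lemma mlin_cons x : multilinear (fun s => phi (x :: s)).
Proof. by move=> s t a y z; exact: (phiL (x :: s)). Qed.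

Lemma mlin_map (U : lmodType K) (g : {linear U -> V}) :
  multilinear (fun s => phi (map g s)).
Proof. by move=> s t a y z; rewrite !map_cat /= linearP phiL. Qed.

Lemma mlin_comp (U : lmodType K) (g : W -> U) :
  linear g -> multilinear (fun s => g (phi s)).
Proof. by move=> gL s t a y z; rewrite phiL gL. Qed.

Lemma tlift_sum (I : Type) (r : seq I) (F : I -> seq V) :
  tlift phi (\sum_(i <- r) tens (F i)) = \sum_(i <- r) phi (F i).
Proof.
elim: r => [|i r ih]; first by rewrite !big_nil; exact: tlift_zero.
by rewrite !big_cons [LHS]tlift_add // tlift_tens // ih.
Qed.

Lemma tliftD x y : tlift phi (x + y) = tlift phi x + tlift phi y.
Proof. exact: tlift_add. Qed.

End Multilinear.

Lemma mlin_add (K : fieldType) (V W : lmodType K) (phi psi : seq V -> W) :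
  multilinear phi -> multilinear psi -> multilinear (fun s => phi s + psi s).
Proof.
by move=> h k s t a y z; rewrite h k scalerDr !addrA; congr (_ + _); rewrite addrAC.
Qed.

Lemma mlin_opp (K : fieldType) (V W : lmodType K) (phi : seq V -> W) :
  multilinear phi -> multilinear (fun s => - phi s).
Proof. by move=> h s t a y z; rewrite h opprD scalerN. Qed.

Lemma mlin_if (K : fieldType) (V W : lmodType K) (b : pred nat)
    (phi psi : seq V -> W) :
  multilinear phi -> multilinear psi ->
  multilinear (fun s => if b (size s) then phi s else psi s).
Proof.
move=> h k s t a y z; rewrite !size_cat /=.
by case: ifP => _; rewrite ?h ?k.
Qed.

HB.instance Definition _ (K : fieldType) (H : gspace K) :=
  GRing.isLinear.Build K H H *:%R (@parity K H) (@parity_linear K H).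

(** A cochain on words is a linear form on the tensor coalgebra with values in
    [W]; [dpull m] is the transpose of the coderivation of [m]. The inner
    operation may have no argument: for multilinear cochains these terms vanish
    when [m [::] = 0], and sums over all cuts need no side condition. *)
Definition dpull (K : fieldType) (H : gspace K) (W : zmodType) (m : seq H -> H)
    (phi : seq H -> W) (w : seq H) : W :=
  \sum_(c <- cuts w) \sum_(d <- cuts c.2)
     phi (map (@parity K H) c.1 ++ m d.1 :: d.2).

(** The transpose of the coalgebra map of [f]. *)
Definition fpull (K : fieldType) (H H' : lmodType K) (W : zmodType)
    (f : seq H -> H') (phi : seq H' -> W) (w : seq H) : W :=
  \sum_(p <- splits w) phi (map f p).

(** The index of the inner operation of a coderivation changes from the arity [k]
    of the outer operation to the arity [l] of the inner one. *)
Lemma big_triangle (W : zmodType) n (G : nat -> nat -> W) :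
  (forall j, G j 0%N = 0) ->
  \sum_(1 <= k < n.+1) \sum_(0 <= j < k) G j (n.+1 - k)%N =
  \sum_(0 <= j < n.+1) \sum_(0 <= l < (n - j).+1) G j l.
Proof.
elim: n G => [|n ih] G G0.
  by rewrite big_geq // big_nat1 subnn big_nat1 G0.
rewrite [RHS]big_nat_recl // -(ih (fun j => G j.+1)) // subn0.
rewrite [X in _ = X + _]big_nat_recl // G0 add0r.
rewrite big_add1 /=.
transitivity (\sum_(0 <= k < n.+1) (G 0%N (n.+1 - k)%N +
   \sum_(0 <= j < k) G j.+1 (n.+1 - k)%N)).
  by apply: eq_bigr => k _; rewrite big_nat_recl // subSS.
rewrite big_split /=; congr (_ + _).
  rewrite big_nat_rev /= add0n; apply: eq_big_nat => k /andP[_ kn].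
  by rewrite subKn.
by rewrite big_nat_recl // big_geq // add0r big_add1.
Qed.

Lemma big_cuts_nat (T : Type) (W : zmodType) (w : seq T) (g : seq T -> seq T -> W) :
  \sum_(c <- cuts w) g c.1 c.2 = \sum_(0 <= i < (size w).+1) g (take i w) (drop i w).
Proof. by rewrite cuts_take_drop big_map /index_iota subn0. Qed.

Section Pull.
Variables (K : fieldType) (H : gspace K).
Variable (m : seq H -> H).
Hypothesis m0 : m [::] = 0.

Lemma coder_wordE w : coder_word m w = dpull m (@tens K H) w.
Proof.
rewrite /coder_word /dpull.
rewrite (big_triangle _ (G := fun j l => tens (map (@parity K H) (take j w)
   ++ m (take l (drop j w)) :: drop (j + l) w))); last first.
  by move=> j; rewrite take0 m0 mlin0 //; exact: tens_multilinear.
rewrite (big_cuts_nat w (fun a b => \sum_(d <- cuts b)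
  tens (map (@parity K H) a ++ m d.1 :: d.2))).
apply: eq_bigr => j _.
rewrite (big_cuts_nat _ (fun b c => tens (map (@parity K H) _ ++ m b :: c))).
by rewrite size_drop; apply: eq_bigr => l _; rewrite drop_drop addnC.
Qed.

Section Lift.
Variables (W : lmodType K) (phi : seq H -> W).
Hypothesis phiL : multilinear phi.

Lemma tlift_coder_word w : tlift phi (coder_word m w) = dpull m phi w.
Proof.
rewrite coder_wordE /dpull; elim: (cuts w) => [|c L ih].
  by rewrite !big_nil; exact: tlift_zero.
by rewrite !big_cons tliftD // tlift_sum // ih.
Qed.

Lemma dpull_multilinear : multilinear m -> multilinear (dpull m phi).
Proof.
move=> mL s t a x y; rewrite -!tlift_coder_word.
by rewrite coder_word_multilinear // tlift_linear.
Qed.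
End Lift.

Lemma fpull_multilinear (H' : gspace K) (W : lmodType K) (f : seq H -> H')
  (phi : seq H' -> W) : multilinear f -> multilinear phi ->
  multilinear (fpull f phi).
Proof.
move=> fL phiL s t a x y.
have E w : fpull f phi w = tlift phi (comor_word f w) by rewrite tlift_sum.
by rewrite !E comor_word_multilinear // tlift_linear.
Qed.
End Pull.

(** * Compositions of pullbacks *)

Lemma parityK (K : fieldType) (H : gspace K) (v : H) : parity (parity v) = v.
Proof.
have [s us hs] := gpr_supp v.
rewrite (parityE us hs) linear_sum /= [RHS](gpr_sum_supp us hs).
apply: eq_bigr => d _; rewrite linearZ /= (@parity_homog _ _ d); last first.
  by rewrite /homog gpr_id.
by rewrite scalerA -expfzMl mulrNN mulr1 exp1rz scale1r.
Qed.

Lemma map_parityK (K : fieldType) (H : gspace K) (w : seq H) :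
  map (@parity K H) (map (@parity K H) w) = w.
Proof. by rewrite mapK //; exact: parityK. Qed.

Section CutsNest.
Variables (T : Type) (W : zmodType).
Implicit Types (w : seq T) (g : seq T -> seq T -> seq T -> seq T -> seq T -> W).

(** A word cut into five pieces, grouped in two ways: the middle three as an
    operation inside an operation, or the second and fourth as two operations
    side by side. *)
Lemma cuts_nested w g :
  \sum_(c <- cuts w) \sum_(d <- cuts c.2) \sum_(s <- cuts c.1)
    \sum_(t <- cuts d.2) g s.1 s.2 d.1 t.1 t.2 =
  \sum_(c <- cuts w) \sum_(d <- cuts c.2) \sum_(s <- cuts d.1)
    \sum_(t <- cuts s.2) g c.1 s.1 t.1 t.2 d.2.
Proof.
under eq_bigr => c _ do rewrite exchange_big /=.
rewrite (cutsA w (fun a b c => \sum_(d <- cuts c)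
    \sum_(t <- cuts d.2) g a b d.1 t.1 t.2)).
apply: eq_bigr => c _.
rewrite (cutsA c.2 (fun s z e => \sum_(t <- cuts z) g c.1 s t.1 t.2 e)).
by apply: eq_bigr => s _; rewrite (cutsA s.2 (g c.1 s.1)).
Qed.

Lemma cuts_apart w g :
  \sum_(c <- cuts w) \sum_(d <- cuts c.2) \sum_(s <- cuts c.1)
    \sum_(t <- cuts s.2) g s.1 t.1 t.2 d.1 d.2 =
  \sum_(c <- cuts w) \sum_(d <- cuts c.2) \sum_(s <- cuts d.2)
    \sum_(t <- cuts s.2) g c.1 d.1 s.1 t.1 t.2.
Proof.
under eq_bigr => c _ do rewrite exchange_big /=.
rewrite (cutsA w (fun a b r => \sum_(d <- cuts r)
    \sum_(t <- cuts b) g a t.1 t.2 d.1 d.2)).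
apply: eq_bigr => c _.
under eq_bigr => d _ do rewrite exchange_big /=.
exact: (cutsA c.2 (fun b e r => \sum_(d <- cuts r) g c.1 b e d.1 d.2)).
Qed.

Lemma big_cuts_last w (F : seq T -> W) :
  \sum_(c <- cuts w) (if nilp c.2 then F c.1 else 0) = F w.
Proof.
elim: w F => [|x w ih] F; first by rewrite /= big_seq1.
rewrite (big_cuts_cons x w (fun a b => if nilp b then F a else 0)) add0r.
exact: (ih (fun a => F (x :: a))).
Qed.

Lemma big_cuts_first w (F : seq T -> W) :
  \sum_(c <- cuts w) (if nilp c.1 then F c.2 else 0) = F w.
Proof.
case: w => [|x w]; first by rewrite /= big_seq1.
by rewrite /= big_cons big_map big1 // addr0.
Qed.

End CutsNest.

(** The parity operator turns the degree of a map into a sign rule that makes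
    sense on all words, not just on homogeneous ones. *)
Definition even_map (K : fieldType) (H H' : gspace K) (f : seq H -> H') :=
  forall w, parity (f w) = f (map (@parity K H) w).

Definition odd_op (K : fieldType) (H : gspace K) (m : seq H -> H) :=
  forall w, parity (m w) = - m (map (@parity K H) w).

Section Composition.
Variables (K : fieldType) (H H' : gspace K).
Local Notation eps := (map (@parity K _)).

Lemma dpull_mid (W : zmodType) (m : seq H -> H) (phi : seq H -> W) s y t :
  dpull m phi (s ++ y :: t) =
  \sum_(c <- cuts s) \sum_(d <- cuts c.2)
     phi (eps c.1 ++ m d.1 :: d.2 ++ y :: t) +
  \sum_(c <- cuts s) \sum_(d <- cuts t)
     phi (eps c.1 ++ m (c.2 ++ y :: d.1) :: d.2) +
  \sum_(c <- cuts t) \sum_(d <- cuts c.2)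
     phi (eps s ++ parity y :: eps c.1 ++ m d.1 :: d.2).
Proof.
rewrite /dpull cuts_mid big_cat !big_map /=; congr (_ + _); last first.
  by apply: eq_bigr => c _; apply: eq_bigr => d _; rewrite map_cat -catA.
rewrite -big_split; apply: eq_bigr => c _.
by rewrite cuts_mid big_cat !big_map.
Qed.

(** The square of a coderivation: two operations applied side by side occur
    twice, with opposite signs as each of them is odd, so that only nested
    operations remain. *)
Lemma dpull_dpull (W : lmodType K) (m : seq H -> H) (phi : seq H -> W) w :
  multilinear phi -> odd_op m ->
  dpull m (dpull m phi) w =
  \sum_(c <- cuts w) \sum_(d <- cuts c.2) phi (c.1 ++ dpull m m d.1 :: d.2).
Proof.
move=> phiL mO; rewrite {1}/dpull.
under eq_bigr => c _ do under eq_bigr => d _ do rewrite dpull_mid.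
under eq_bigr => c _ do rewrite 2!big_split.
rewrite 2!big_split /= addrAC.
rewrite [X in X + _](_ : _ = 0) ?add0r; last first.
  apply/eqP; rewrite addr_eq0; apply/eqP.
  transitivity (\sum_(c <- cuts w) \sum_(d <- cuts c.2) \sum_(s <- cuts d.2)
    \sum_(t <- cuts s.2) phi (c.1 ++ m (eps d.1) :: eps s.1 ++ m t.1 :: t.2)).
    rewrite -(cuts_apart w (fun a b c d e =>
      phi (a ++ m (eps b) :: eps c ++ m d :: e))).
    apply: eq_bigr => c _; apply: eq_bigr => d _; rewrite cuts_map big_map.
    apply: eq_bigr => s _; rewrite cuts_map big_map map_parityK.
    by apply: eq_bigr.
  rewrite -sumrN; apply: eq_bigr => c _; rewrite -sumrN; apply: eq_bigr => d _.
  rewrite -sumrN; apply: eq_bigr => s _; rewrite -sumrN; apply: eq_bigr => t _.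
  by rewrite map_parityK mO mlinN // opprK.
transitivity (\sum_(c <- cuts w) \sum_(d <- cuts c.2) \sum_(s <- cuts d.1)
    \sum_(t <- cuts s.2) phi (c.1 ++ m (eps s.1 ++ m t.1 :: t.2) :: d.2)).
  rewrite -(cuts_nested w (fun a1 a2 b c1 c2 =>
     phi (a1 ++ m (eps a2 ++ m b :: c1) :: c2))).
  apply: eq_bigr => c _; apply: eq_bigr => d _; rewrite cuts_map big_map.
  by apply: eq_bigr => s _; rewrite map_parityK.
apply: eq_bigr => c _; apply: eq_bigr => d _; rewrite mlin_sum //.
by apply: eq_bigr => s _; rewrite mlin_sum.
Qed.

Section Defect.
Variables (W : lmodType K) (m : seq H -> H) (m' : seq H' -> H') (f : seq H -> H').
Variable phi : seq H' -> W.
Hypotheses (phiL : multilinear phi) (fE : even_map f).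

(** The failure of [f] to be a morphism, composed with the projection of the
    tensor coalgebra of H' onto H'. *)
Definition defect (v : seq H) : H' := dpull m f v - fpull f m' v.

Lemma dpull_fpull w : dpull m (fpull f phi) w =
  \sum_(c <- cuts w) \sum_(d <- cuts c.2) \sum_(p <- splits c.1)
    \sum_(q <- splits d.2)
      phi (eps (map f p) ++ dpull m f d.1 :: map f q).
Proof.
rewrite {1}/dpull /fpull.
under eq_bigr => c _ do under eq_bigr => d _ do rewrite big_splits_mid.
transitivity (\sum_(c <- cuts w) \sum_(d <- cuts c.2) \sum_(s <- cuts d.1)
    \sum_(t <- cuts s.2) \sum_(p <- splits (eps c.1)) \sum_(q <- splits d.2)
      phi (map f p ++ f (eps s.1 ++ m t.1 :: t.2) :: map f q)).
  rewrite -(cuts_nested w (fun a1 a2 b c1 c2 => \sum_(p <- splits (eps a1))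
    \sum_(q <- splits c2) phi (map f p ++ f (eps a2 ++ m b :: c1) :: map f q))).
  apply: eq_bigr => c _; apply: eq_bigr => d _; rewrite cuts_map big_map.
  apply: eq_bigr => s _; apply: eq_bigr => t _; apply: eq_bigr => p _.
  by apply: eq_bigr => q _; rewrite map_cat.
apply: eq_bigr => c _; apply: eq_bigr => d _.
under eq_bigr => s _ do rewrite exchange_big /=.
rewrite exchange_big splits_map big_map; apply: eq_bigr => p _ /=.
under eq_bigr => s _ do rewrite exchange_big /=.
rewrite exchange_big; apply: eq_bigr => q _ /=.
rewrite mlin_sum //; apply: eq_bigr => s _; rewrite mlin_sum //.
apply: eq_bigr => t _; congr (phi (_ ++ _)).
by rewrite -!map_comp; apply: eq_map => b /=; rewrite fE.
Qed.

Lemma fpull_dpull w : fpull f (dpull m' phi) w =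
  \sum_(c <- cuts w) \sum_(d <- cuts c.2) \sum_(p <- splits c.1)
    \sum_(q <- splits d.2)
      phi (eps (map f p) ++ fpull f m' d.1 :: map f q).
Proof.
rewrite /fpull /dpull.
transitivity (\sum_(p <- splits w) \sum_(c <- cuts p) \sum_(d <- cuts c.2)
    phi (eps (map f c.1) ++ m' (map f d.1) :: map f d.2)).
  apply: eq_bigr => p _; rewrite cuts_map big_map; apply: eq_bigr => c _.
  by rewrite cuts_map big_map.
rewrite (big_splits_cuts w (fun p q => \sum_(d <- cuts q)
    phi (eps (map f p) ++ m' (map f d.1) :: map f d.2))).
apply: eq_bigr => c _; rewrite [RHS]exchange_big; apply: eq_bigr => p _ /=.
rewrite (big_splits_cuts c.2 (fun a b =>
    phi (eps (map f p) ++ m' (map f a) :: map f b))).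
apply: eq_bigr => d _; rewrite exchange_big; apply: eq_bigr => q _ /=.
by rewrite mlin_sum.
Qed.

(** The coalgebra map of [f] intertwines the coderivations up to a coderivation
    along [f], whose component with values in H' is the defect. *)
Lemma dpull_fpull_defect w :
  dpull m (fpull f phi) w = fpull f (dpull m' phi) w +
  \sum_(c <- cuts w) \sum_(d <- cuts c.2) \sum_(p <- splits c.1)
    \sum_(q <- splits d.2) phi (eps (map f p) ++ defect d.1 :: map f q).
Proof.
rewrite dpull_fpull fpull_dpull -big_split; apply: eq_bigr => c _.
rewrite -big_split; apply: eq_bigr => d _; rewrite -big_split.
apply: eq_bigr => p _; rewrite -big_split; apply: eq_bigr => q _ /=.
by rewrite -mlinD // /defect addrCA subrr addr0.
Qed.

Lemma dpull_fpull_comm w : (forall v, defect v = 0) ->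
  dpull m (fpull f phi) w = fpull f (dpull m' phi) w.
Proof.
move=> d0; rewrite dpull_fpull_defect big1 ?addr0 // => c _.
rewrite big1 // => d _; rewrite big1 // => p _; rewrite big1 // => q _.
by rewrite d0 mlin0.
Qed.

(** When the defect vanishes on shorter words, the correction reduces to the
    term in which the defect takes the whole word. *)
Lemma dpull_fpull_low w :
  (forall v, (size v < size w)%N -> defect v = 0) ->
  dpull m (fpull f phi) w = fpull f (dpull m' phi) w + phi [:: defect w].
Proof.
move=> d0; rewrite dpull_fpull_defect; congr (_ + _).
rewrite -[RHS](big_cuts_first w (fun w => phi [:: defect w])).
apply: (eq_cuts (F := fun a r => \sum_(d <- cuts r) \sum_(p <- splits a)
  \sum_(q <- splits d.2) phi (eps (map f p) ++ defect d.1 :: map f q))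
  (G := fun a r => if nilp a then phi [:: defect r] else 0)) => a r wE.
rewrite -[RHS](big_cuts_last r (fun r => if nilp a then phi [:: defect r] else 0)).
apply: (eq_cuts (F := fun v b => \sum_(p <- splits a) \sum_(q <- splits b)
   phi (eps (map f p) ++ defect v :: map f q))
   (G := fun v b => if nilp b then if nilp a then phi [:: defect v] else 0 else 0))
  => v b rE.
have [/andP[] | ab] := boolP (nilp a && nilp b).
  by case: a {wE} => // _; case: b {rE} => // _; rewrite !big_seq1.
rewrite [RHS](_ : _ = 0); last by move: ab; case: (nilp a); case: (nilp b).
rewrite big1 // => p _; rewrite big1 // => q _; rewrite d0 ?mlin0 // wE rE.
by case: a b ab {wE rE} => [|x a] [|y b] //= _; lia.
Qed.

End Defect.
End Composition.

(** * Leading terms of the pullbacks *)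

(** The transpose of an operator on tensor powers extending [t], in which [s]
    twists the letters that [t] has passed: the differential of tensor powers
    is the case of a differential [t] and the parity [s]. *)
Fixpoint ins (V : Type) (W : zmodType) (s t : V -> V) (phi : seq V -> W)
    (w : seq V) : W :=
  if w is x :: w' then phi (t x :: w') + ins s t (fun u => phi (s x :: u)) w' else 0.

Section Ins.
Variables (K : fieldType) (V W : lmodType K).
Implicit Types (s t : {linear V -> V}) (phi psi : seq V -> W).

Lemma eq_ins (s t : V -> V) phi psi w :
  (forall u, size u = size w -> phi u = psi u) -> ins s t phi w = ins s t psi w.
Proof.
elim: w phi psi => //= x w ih phi psi h; rewrite h //; congr (_ + _).
by apply: ih => u uw; apply: h; rewrite /= uw.
Qed.

Lemma ins_comp (U : zmodType) (g : {additive W -> U}) (s t : V -> V) phi w :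
  ins s t (g \o phi) w = g (ins s t phi w).
Proof.
elim: w phi => [|x w ih] phi /=; first by rewrite raddf0.
by rewrite raddfD; congr (_ + _); exact: (ih (fun u => phi (s x :: u))).
Qed.

Lemma insD (s t : V -> V) phi psi w :
  ins s t (fun u => phi u + psi u) w = ins s t phi w + ins s t psi w.
Proof.
elim: w phi psi => [|x w ih] phi psi /=; first by rewrite addr0.
by rewrite (ih (fun u => phi (s x :: u)) (fun u => psi (s x :: u))) addrACA.
Qed.

Lemma ins_lin (s t : V -> V) a phi psi w :
  ins s t (fun u => a *: phi u + psi u) w = a *: ins s t phi w + ins s t psi w.
Proof.
rewrite (insD s t (fun u => a *: phi u)); congr (_ + _).
exact: (ins_comp ( *:%R a : {additive W -> W})).
Qed.

Lemma ins0 (s t : V -> V) phi w : (forall u, size u = size w -> phi u = 0) ->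
  ins s t phi w = 0.
Proof.
elim: w phi => //= x w ih phi h; rewrite h // add0r.
by apply: ih => u uw; apply: h; rewrite /= uw.
Qed.

Lemma ins_multilinear s t phi : multilinear phi -> multilinear (ins s t phi).
Proof.
move=> phiL u v a x y; elim: u phi phiL => [|z u ih] phi phiL /=.
  rewrite linearP (phiL [::]) scalerDr addrACA -ins_lin; congr (_ + _).
  by apply: eq_ins => r _; rewrite linearP (phiL [::]).
by rewrite (phiL (t z :: u)) (ih _ (mlin_cons phiL _)) scalerDr addrACA.
Qed.

Lemma ins_map0 s t (g : V -> V) phi w : multilinear phi ->
  (forall x, t (g x) = 0) -> ins s t phi (map g w) = 0.
Proof.
move=> phiL tg; elim: w phi phiL => //= x w ih phi phiL.
by rewrite tg (mlin0 phiL [::]) add0r; apply: ih; exact: mlin_cons.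
Qed.

(** A contraction [h] of the differential [d] onto the image of [P] extends to
    tensor powers, with [P] applied to the letters before the one hit by [h]. *)
Lemma ins_homotopy (s d h P : {linear V -> V}) phi w : multilinear phi ->
  (forall x, s (s x) = x) ->
  (forall x, P (s x) = s (P x)) -> (forall x, d (s x) = - s (d x)) ->
  (forall x, h (s x) = - s (h x)) ->
  (forall x, P (d x) = 0) -> (forall x, d (P x) = 0) ->
  (forall x, d (h x) + h (d x) = x - P x) ->
  ins s d (ins (s \o P) h phi) w + ins (s \o P) h (ins s d phi) w =
  phi w - phi (map P w).
Proof.
move=> phiL ss Ps ds hs Pd dP dh; elim: w phi phiL => [|x w ih] phi phiL /=.
  by rewrite addr0 subrr.
have phi0 r : phi (0 :: r) = 0 by exact: (mlin0 phiL [::]).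
rewrite (insD s d (fun u => phi (h (s x) :: u))).
rewrite (insD (s \o P) h (fun u => phi (d (s (P x)) :: u))).
have -> : ins (s \o P) h (fun u => phi (s (P (d x)) :: u)) w = 0.
  by apply: ins0 => u _; rewrite Pd linear0.
have -> : ins (s \o P) h (fun u => phi (d (s (P x)) :: u)) w = 0.
  by apply: ins0 => u _; rewrite ds dP linear0 oppr0.
have -> : ins s d (fun u => phi (h (s x) :: u)) w =
          - ins s d (fun u => phi (s (h x) :: u)) w.
  rewrite -(ins_comp (-%R : {additive W -> W})); apply: eq_ins => u _ /=.
  by rewrite hs (mlinN phiL [::]).
have phiPL := mlin_cons phiL (P x).
have -> : ins s d (fun u => ins (s \o P) h
      (fun v => phi (s (P (s x)) :: v)) u) w =
   ins s d (ins (s \o P) h (fun v => phi (P x :: v))) w by rewrite Ps ss.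
have -> : ins (s \o P) h (fun u => ins s d
      (fun v => phi (s (s (P x)) :: v)) u) w =
   ins (s \o P) h (ins s d (fun v => phi (P x :: v))) w by rewrite ss.
have {}ih := ih _ phiPL.
have -> : phi (x :: w) = phi (d (h x) :: w) + phi (h (d x) :: w) + phi (P x :: w).
  by rewrite -!(mlinD phiL [::]) /= dh subrK.
rewrite addr0 add0r -[RHS]addrA -ih addrACA -addrA addrC !addrA -!addrA.
by rewrite addNKr; congr (_ + _); rewrite addrA addrC.
Qed.

End Ins.

Section Low.
Variables (K : fieldType) (H : gspace K).

(** Operations of arity at least two shorten words, so that only the linear part
    of a coderivation reaches the lowest length on which a cochain lives. *)
Lemma dpull_low (W : lmodType K) (m : seq H -> H) (phi : seq H -> W) w :
  m [::] = 0 -> multilinear phi ->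
  (forall s, (size s < size w)%N -> phi s = 0) ->
  dpull m phi w = ins (@parity K H) (fun x => m [:: x]) phi w.
Proof.
move=> m0; elim: w phi => [|x w ih] phi phiL phi0.
  by rewrite /dpull /= !big_seq1 /= m0 (mlin0 phiL [::]).
rewrite /dpull (big_cuts_cons x w (fun a r => \sum_(d <- cuts r)
  phi (map (@parity K H) a ++ m d.1 :: d.2))) /=.
congr (_ + _); last first.
  by apply: ih => [|s sw]; [exact: mlin_cons | exact: phi0].
rewrite big_cons big_map m0 (mlin0 phiL [::]) add0r /=.
case: w phi0 {ih} => [|y w] phi0; first by rewrite big_seq1.
rewrite (big_cuts_cons y w (fun b c => phi (m (x :: b) :: c))).
rewrite (@eq_cuts _ _ w (fun b c => phi (m [:: x, y & b] :: c)) (fun _ _ => 0)).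
  by rewrite big1 // addr0.
by move=> b c wE; apply: phi0 => /=; rewrite wE; lia.
Qed.

Lemma eq_dpull (W : lmodType K) (m m' : seq H -> H) (phi psi : seq H -> W) w :
  m [::] = 0 -> m' [::] = 0 -> multilinear phi -> multilinear psi ->
  (forall s, (size s <= size w)%N -> m s = m' s) ->
  (forall s, (size s <= size w)%N -> phi s = psi s) ->
  dpull m phi w = dpull m' psi w.
Proof.
move=> m0 m'0 phiL psiL mE phiE.
apply: (eq_cuts (F := fun a r => \sum_(d <- cuts r) phi (map _ a ++ m d.1 :: d.2))
  (G := fun a r => \sum_(d <- cuts r) psi (map _ a ++ m' d.1 :: d.2))) => a r wE.
apply: (eq_cuts (F := fun b c => phi (map _ a ++ m b :: c))
  (G := fun b c => psi (map _ a ++ m' b :: c))) => b c rE.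
case: b rE => [|x b] rE; first by rewrite m0 m'0 !mlin0.
rewrite mE ?phiE // wE rE ?size_cat ?size_map /=; lia.
Qed.

Variable H' : lmodType K.

Lemma fpull_cons (W : zmodType) (f : seq H -> H') (phi : seq H' -> W) x w :
  fpull f phi (x :: w) =
  \sum_(c <- cuts w) fpull f (fun p => phi (f (x :: c.1) :: p)) c.2.
Proof. exact: big_splits_cons. Qed.

Lemma eq_fpull (W : zmodType) (f g : seq H -> H') (phi psi : seq H' -> W) w :
  (forall s, (size s <= size w)%N -> f s = g s) ->
  (forall s, (size s <= size w)%N -> phi s = psi s) ->
  fpull f phi w = fpull g psi w.
Proof.
have [n] := ubnP (size w); elim: n w phi psi => // n ih [|x w] phi psi wn fE phiE.
  by rewrite /fpull !big_seq1 phiE.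
rewrite !fpull_cons.
apply: (eq_cuts (F := fun a b => fpull f (fun p => phi (f (x :: a) :: p)) b)
  (G := fun a b => fpull g (fun p => psi (g (x :: a) :: p)) b)) => a b wE.
apply: ih => [|s sb|s sb].
- by move: wn; rewrite /= wE; lia.
- by apply: fE; rewrite /= wE; lia.
- by rewrite fE ?phiE //= wE; lia.
Qed.

(** Likewise only the decomposition into single letters does not shorten. *)
Lemma fpull_low (W : zmodType) (f : seq H -> H') (phi : seq H' -> W) w :
  (forall s, (size s < size w)%N -> phi s = 0) ->
  fpull f phi w = phi (map (fun x => f [:: x]) w).
Proof.
elim: w phi => [|x w ih] phi phi0; first by rewrite /fpull big_seq1.
rewrite fpull_cons /= -(ih (fun u => phi (f [:: x] :: u))) => [|s sw]; last exact: phi0.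
rewrite -[RHS](big_cuts_first w (fun w => fpull f (fun u => phi (f [:: x] :: u)) w)).
apply: (eq_cuts (F := fun a b => fpull f (fun p => phi (f (x :: a) :: p)) b)
  (G := fun a b => if nilp a then fpull f (fun u => phi (f [:: x] :: u)) b else 0)).
case=> [|y a] b wE //=.
rewrite (eq_fpull (g := f) (psi := fun => 0)) ?[LHS]big1 // => s sb.
by apply: phi0; rewrite /= wE /=; lia.
Qed.

(** The top component of a coalgebra map enters only through the decomposition
    in which the whole word is one block. *)
Lemma fpull_top (W : zmodType) (f g : seq H -> H') (phi : seq H' -> W) w :
  w != [::] -> (forall s, (size s < size w)%N -> f s = g s) ->
  fpull f phi w - phi [:: f w] = fpull g phi w - phi [:: g w].
Proof.
case: w => // x w _ fE; apply/eqP.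
rewrite subr_eq addrAC -addrA [X in _ == X]addrC -subr_eq; apply/eqP.
rewrite !fpull_cons -sumrB.
rewrite -[RHS](big_cuts_last w
  (fun a => phi [:: f (x :: a)] - phi [:: g (x :: a)])).
apply: (eq_cuts (F := fun a b => fpull f (fun p => phi (f (x :: a) :: p)) b -
     fpull g (fun p => phi (g (x :: a) :: p)) b)
  (G := fun a b => if nilp b then phi [:: f (x :: a)] - phi [:: g (x :: a)] else 0)).
move=> a [|y b] wE; first by rewrite /fpull !big_seq1.
rewrite /= fE; last by rewrite /= wE /=; lia.
rewrite (@eq_fpull _ f g _ (fun p => phi (g (x :: a) :: p))) ?subrr // => s sb.
by apply: fE; move: sb; rewrite /= wE /=; lia.
Qed.

End Low.

(** * Degrees and signs *)

Section Homogeneous.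
Variables (K : fieldType) (H : gspace K).
Implicit Types (x y : H) (d e : int).

Lemma homog0 d : homog d (0 : H).
Proof. by rewrite /homog linear0. Qed.

Lemma homogD d x y : homog d x -> homog d y -> homog d (x + y).
Proof. by move=> /eqP hx /eqP hy; rewrite /homog linearD /= hx hy. Qed.

Lemma homogZ d a x : homog d x -> homog d (a *: x).
Proof. by move=> /eqP hx; rewrite /homog linearZ /= hx. Qed.

Lemma homogN d x : homog d x -> homog d (- x).
Proof. by move=> hx; rewrite -scaleN1r homogZ. Qed.

Lemma homog_parity d x : homog d x -> homog d (parity x).
Proof. by move=> hx; rewrite (parity_homog hx) homogZ. Qed.

Lemma homog_map_parity ds (w : seq H) :
  all2 (@homog K H) ds w -> all2 (@homog K H) ds (map (@parity K H) w).
Proof.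
by elim: ds w => [|d ds ih] [|x w] //= /andP[/homog_parity-> /ih->].
Qed.

Lemma all2_homog_cat ds es (u v : seq H) :
  all2 (@homog K H) ds u -> all2 (@homog K H) es v ->
  all2 (@homog K H) (ds ++ es) (u ++ v).
Proof. by elim: ds u => [|d ds ih] [|x u] //= /andP[-> /ih]; apply. Qed.

Lemma eq_mlin_homog (W : lmodType K) (phi psi : seq H -> W) :
  multilinear phi -> multilinear psi ->
  (forall ds w, all2 (@homog K H) ds w -> phi w = psi w) -> phi =1 psi.
Proof.
move=> phiL psiL h w.
suff gen t ds s : all2 (@homog K H) ds s -> phi (s ++ t) = psi (s ++ t).
  exact: (gen w [::] [::]).
elim: t ds s => [|x t ih] ds s hs; first by rewrite cats0; exact: (h ds).
have [r _ ->] := gpr_sum x; rewrite !mlin_sum //.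
apply: eq_bigr => d _; rewrite -!cat_rcons; apply: (ih (rcons ds d)).
by rewrite -!cats1 all2_homog_cat //= /homog gpr_id eqxx.
Qed.

Lemma mlin_parity (W : lmodType K) (phi : seq H -> W) ds w : multilinear phi ->
  all2 (@homog K H) ds w ->
  phi (map (@parity K H) w) = ((-1 : K) ^ (\sum_(d <- ds) d)) *: phi w.
Proof.
move=> phiL dw; have := congr1 (tlift phi) (tens_parity [::] [::] dw).
by rewrite /= !cats0 [X in _ = X -> _]tlift_scale // !tlift_tens.
Qed.

End Homogeneous.

Lemma homog_cuts (K : fieldType) (H H' : gspace K) e ds (w : seq H)
    (F : seq H -> seq H -> H') :
  all2 (@homog K H) ds w ->
  (forall ds1 ds2 a b, ds = ds1 ++ ds2 -> w = a ++ b ->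
     all2 (@homog K H) ds1 a -> all2 (@homog K H) ds2 b -> homog e (F a b)) ->
  homog e (\sum_(c <- cuts w) F c.1 c.2).
Proof.
elim: w ds F => [|x w ih] [|d ds] // F.
  by rewrite /= big_seq1 => _ h; exact: (h [::] [::]).
move=> /= /andP[dx dw] h; rewrite big_cons big_map; apply: homogD.
  by apply: (h [::] (d :: ds)) => //=; rewrite dx.
apply: (ih ds (fun a b => F (x :: a) b)) => // ds1 ds2 a b dsE wE da db.
by apply: (h (d :: ds1) ds2) => //; rewrite ?dsE ?wE //= dx.
Qed.

Lemma has_degree_cons (K : fieldType) (H H' : gspace K) e d x
    (phi : seq H -> H') :
  homog d x -> has_degree e phi -> has_degree (d + e) (fun w => phi (x :: w)).
Proof.
move=> dx h ds w _ dw; rewrite addrA [_ + d]addrC -(big_cons _ _ d ds xpredT id).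
by apply: h => //=; rewrite dx.
Qed.

Section Degree.
Variables (K : fieldType) (H H' : gspace K).

Lemma even_map_degree (f : seq H -> H') :
  multilinear f -> has_degree 0 f -> f [::] = 0 -> even_map f.
Proof.
move=> fL fd f0 w.
apply: (@eq_mlin_homog _ _ _ (fun w => parity (f w)) (fun w => f (map (@parity K H) w))).
- by apply: mlin_comp => //; exact: parity_linear.
- exact: mlin_map.
move=> ds [|x u] dw; first by rewrite f0 linear0.
rewrite (mlin_parity fL dw) (parity_homog (d := \sum_(d <- ds) d)) //.
by have := fd ds (x :: u) isT dw; rewrite addr0.
Qed.

Lemma odd_op_degree (m : seq H -> H) :
  multilinear m -> has_degree 1 m -> m [::] = 0 -> odd_op m.
Proof.
move=> mL md m0 w.
apply: (@eq_mlin_homog _ _ _ (fun w => parity (m w)) (fun w => - m (map (@parity K H) w))).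
- by apply: mlin_comp => //; exact: parity_linear.
- by apply: mlin_opp; exact: mlin_map.
move=> ds [|x u] dw; first by rewrite m0 linear0 oppr0.
rewrite (mlin_parity mL dw) (parity_homog (md ds (x :: u) isT dw)).
by rewrite expfzDr ?oppr_eq0 ?oner_eq0 // expr1z mulrN1 scaleNr.
Qed.

Lemma has_degreeD e (phi psi : seq H -> H') :
  has_degree e phi -> has_degree e psi -> has_degree e (fun w => phi w + psi w).
Proof. by move=> h k ds w w0 dw; rewrite homogD ?h ?k. Qed.

Lemma has_degreeN e (phi : seq H -> H') :
  has_degree e phi -> has_degree e (fun w => - phi w).
Proof. by move=> h ds w w0 dw; rewrite homogN ?h. Qed.

Lemma has_degree_if e (b : pred nat) (phi psi : seq H -> H') :
  has_degree e phi -> has_degree e psi ->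
  has_degree e (fun w => if b (size w) then phi w else psi w).
Proof. by move=> h k ds w w0 dw; case: ifP => _; [exact: h | exact: k]. Qed.

Lemma has_degree_dpull e (m : seq H -> H) (phi : seq H -> H') :
  m [::] = 0 -> multilinear phi -> has_degree 1 m -> has_degree e phi ->
  has_degree (e + 1) (dpull m phi).
Proof.
move=> m0 phiL md pd ds w _ dw.
apply: (homog_cuts (F := fun a r => \sum_(d <- cuts r) phi (map _ a ++ m d.1 :: d.2)) dw).
move=> ds1 ds2 a r -> _ da dr.
apply: (homog_cuts (F := fun b c => phi (map _ a ++ m b :: c)) dr).
move=> ds3 ds4 [|x b] c -> _ db dc; first by rewrite m0 mlin0 // homog0.
have := pd (ds1 ++ (\sum_(d <- ds3) d + 1) :: ds4) (map (@parity K H) a ++ m (x :: b) :: c).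
rewrite !big_cat big_cons /=.
have -> : \sum_(d <- ds1) d + (\sum_(d <- ds3) d + 1 + \sum_(d <- ds4) d) + e =
  \sum_(d <- ds1) d + (\sum_(d <- ds3) d + \sum_(d <- ds4) d) + (e + 1) by lia.
apply; first by case: (map _ a).
by rewrite all2_homog_cat //= ?homog_map_parity // md.
Qed.

Lemma has_degree_fpull (H'' : gspace K) e (f : seq H -> H') (phi : seq H' -> H'') :
  has_degree 0 f -> has_degree e phi -> has_degree e (fpull f phi).
Proof.
move=> fd pd ds w; have [n] := ubnP (size w).
elim: n ds w e phi pd => // n ih [|d ds] [|x w] e phi pd // wn _ /= /andP[dx dw].
rewrite fpull_cons.
apply: (homog_cuts (F := fun a b => fpull f (fun p => phi (f (x :: a) :: p)) b) dw).
move=> ds1 ds2 a b -> wE da db.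
have dfa : homog (d + \sum_(d <- ds1) d) (f (x :: a)).
  have := fd (d :: ds1) (x :: a) isT; rewrite addr0 big_cons; apply.
  by rewrite /= dx.
case: b db wE => [|y b] db wE.
  case: ds2 db => // _; rewrite cats0 /fpull big_seq1 /=.
  have := pd [:: d + \sum_(d <- ds1) d] [:: f (x :: a)] isT.
  by rewrite big_seq1 big_cons; apply; rewrite /= dfa.
have -> : \sum_(j <- d :: ds1 ++ ds2) j + e =
   \sum_(j <- ds2) j + (d + \sum_(d <- ds1) d + e).
  rewrite big_cons big_cat /= [RHS]addrC -!addrA; do 2!congr (_ + _).
  exact: addrC.
apply: ih => //.
- exact: has_degree_cons.
- by move: wn; rewrite /= wE size_cat /=; lia.
Qed.

Lemma has_degree_ins e k (s t : H -> H) (phi : seq H -> H') :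
  (forall d x, homog d x -> homog d (s x)) ->
  (forall d x, homog d x -> homog (d + k) (t x)) ->
  has_degree e phi -> has_degree (e + k) (ins s t phi).
Proof.
move=> sd td pd ds w _; elim: w ds e phi pd => [|x w ih] [|d ds] // e phi pd.
  by move=> _; exact: homog0.
move=> /= /andP[dx dw]; apply: homogD.
  have := pd (d + k :: ds) (t x :: w) isT; rewrite !big_cons /= td //=.
  have -> : d + k + \sum_(j <- ds) j + e = d + \sum_(j <- ds) j + (e + k) by lia.
  exact.
have -> : \sum_(j <- d :: ds) j + (e + k) = \sum_(j <- ds) j + (d + e + k).
  by rewrite big_cons [d + _]addrC -!addrA.
by apply: ih => //; apply: has_degree_cons => //; exact: sd.
Qed.

End Degree.

(** * Relations and morphisms in terms of pullbacks *)

(** The value on the empty word is set to zero, so that the empty factors of a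
    cut contribute nothing to the pullbacks. *)
Definition reduced (K : fieldType) (V W : lmodType K) (m : seq V -> W) (w : seq V) : W :=
  if nilp w then 0 else m w.

Section Reduced.
Variables (K : fieldType).

Lemma reduced_mid (V W : lmodType K) (m : seq V -> W) s x t :
  reduced m (s ++ x :: t) = m (s ++ x :: t).
Proof. by case: s. Qed.

Lemma reduced_multilinear (V W : lmodType K) (m : seq V -> W) :
  multilinear m -> multilinear (reduced m).
Proof. by move=> mL s t a x y; rewrite !reduced_mid mL. Qed.

Lemma reduced_degree (H H' : gspace K) e (m : seq H -> H') :
  has_degree e m -> has_degree e (reduced m).
Proof. by move=> md ds [|x w] // _; exact: md. Qed.

Variable H : gspace K.

Lemma coder_word_reduced (m : seq H -> H) w :
  coder_word m w = dpull (reduced m) (@tens K H) w.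
Proof.
rewrite -coder_wordE // /coder_word; apply: eq_big_nat => k /andP[_ kn].
apply: eq_big_nat => j /andP[_ jk]; rewrite /reduced [nilp _](_ : _ = false) //.
apply/negbTE; rewrite /nilp size_take size_drop -lt0n; case: ifP; lia.
Qed.

Lemma ainf_relationsE (m : seq H -> H) ds w : multilinear m ->
  all2 (@homog K H) ds w ->
  \sum_(1 <= k < (size w).+1) \sum_(0 <= j < k)
    (let l := ((size w).+1 - k)%N in
     ((-1 : K) ^ (\sum_(d <- take j ds) d)) *:
       m (take j w ++ m (take l (drop j w)) :: drop (j + l) w)) =
  dpull (reduced m) (reduced m) w.
Proof.
move=> mL dw.
transitivity (tlift m (coder m (tens w))).
  rewrite (coder_homog mL dw) /=.
  have tls (I : Type) (r : seq I) (F : I -> tensor H) :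
      tlift m (\sum_(i <- r) F i) = \sum_(i <- r) tlift m (F i).
    elim: r => [|i r ih]; first by rewrite !big_nil; exact: tlift_zero.
    by rewrite !big_cons tliftD // ih.
  rewrite tls; apply: eq_bigr => k _; rewrite tls; apply: eq_bigr => j _.
  by rewrite [RHS]tlift_scale // tlift_tens.
rewrite coder_tens // coder_word_reduced -coder_wordE // tlift_coder_word //.
apply: eq_bigr => c _; apply: eq_bigr => d _.
by rewrite reduced_mid.
Qed.

Lemma ainf_relations_dpull (m : seq H -> H) : multilinear m ->
  (forall w, dpull (reduced m) (reduced m) w = 0) -> ainf_relations m.
Proof. by move=> mL m2 ds w dw n; rewrite ainf_relationsE. Qed.

End Reduced.

Lemma aop_dpull (K : fieldType) (A : ainf_algebra K) w :
  dpull (reduced (@aop K A)) (reduced (@aop K A)) w = 0.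
Proof.
have rL := reduced_multilinear (@aop_multilinear K A).
apply: (@eq_mlin_homog _ _ _ (dpull (reduced _) (reduced _)) (fun=> 0)) => //.
- exact: dpull_multilinear.
- by move=> s t a x y; rewrite scaler0 addr0.
move=> ds {}w dw; rewrite -(ainf_relationsE (@aop_multilinear K A) dw).
exact: aop_relations.
Qed.

(** The difference of the two sides of the morphism equation is a coderivation
    along the coalgebra map of [f], hence determined by its component in B. *)
Lemma ainf_morphism_defect (K : fieldType) (A B : ainf_algebra K) (f : seq A -> B) :
  multilinear f -> has_degree 0 f -> f [::] = 0 ->
  (forall w, defect (reduced (@aop K A)) (reduced (@aop K B)) f w = 0) ->
  is_ainf_morphism f.
Proof.
move=> fL fd f0 fm; split=> // x.
have mAL := @aop_multilinear K A; have mBL := @aop_multilinear K B.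
have cmL := comor_word_multilinear fL.
have dAL := coder_word_multilinear mAL; have dBL := coder_word_multilinear mBL.
pose phi w := comor f (coder (@aop K A) (tens w)).
rewrite (@tlift_uniq _ _ _ phi (comor f \o coder (@aop K A))) //; last first.
  by move=> a y z; rewrite /= /coder tlift_linear // /comor tlift_linear.
symmetry; apply: (@tlift_uniq _ _ _ phi (coder (@aop K B) \o comor f)) => [a y z|w].
  by rewrite /= /comor tlift_linear // /coder tlift_linear.
rewrite /phi /= comor_tens // coder_tens //.
rewrite /comor coder_word_reduced -coder_wordE // tlift_coder_word //.
rewrite [RHS](dpull_fpull_comm (m' := reduced (@aop K B)) (phi := @tens K B)) //; last first.
  exact: even_map_degree.
  exact: tens_multilinear.
rewrite /coder /comor_word tlift_sum // /fpull; apply: eq_bigr => p _.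
by rewrite coder_word_reduced.
Qed.

(** * Contractions of a differential *)

Lemma lin_parity (K : fieldType) (H H' : gspace K) k (t : {linear H -> H'}) x :
  (forall j y, homog j y -> homog (j + k) (t y)) ->
  t (parity x) = ((-1 : K) ^ k) *: parity (t x).
Proof.
move=> td; have [s _ ->] := gpr_sum x.
have parS (G : gspace K) (F : int -> G) :
    parity (\sum_(j <- s) F j) = \sum_(j <- s) parity (F j).
  exact: (linear_sum (@parity K G)).
rewrite parS !(linear_sum t) parS scaler_sumr; apply: eq_bigr => j _.
have hj : homog j (gpr H j x) by rewrite /homog gpr_id.
rewrite (parity_homog hj) linearZ /= (parity_homog (td _ _ hj)) scalerA.
rewrite expfzDr ?oppr_eq0 ?oner_eq0 // mulrCA -expfzMl mulrNN mulr1.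
by rewrite exp1rz mulr1.
Qed.

(** The image of [P] is a space of representatives for the cohomology of [d]. *)
Record contraction (K : fieldType) (H : gspace K) (d h P : {linear H -> H}) : Prop := {
  contr_h : forall k x, homog k x -> homog (k - 1) (h x);
  contr_P : forall k x, homog k x -> homog k (P x);
  contr_PP : forall x, P (P x) = P x;
  contr_Pd : forall x, P (d x) = 0;
  contr_dP : forall x, d (P x) = 0;
  contr_dh : forall x, d (h x) + h (d x) = x - P x
}.


Section Projection.
Variables (K : fieldType) (V : lmodType K).

Lemma linear_pack (W : lmodType K) (g : V -> W) : linear g ->
  exists g' : {linear V -> W}, g' =1 g.
Proof.
by move=> gL; exists (HB.pack_for {linear V -> W} g (GRing.isLinear.Build K V W *:%R g gL)).
Qed.

(** A maximal subspace meeting [S] trivially is a complement of [S]. *)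
Lemma projection_exists (S : V -> Prop) : S 0 ->
  (forall a x y, S x -> S y -> S (a *: x + y)) ->
  exists p : {linear V -> V}, (forall x, S (p x)) /\ (forall x, S x -> p x = x).
Proof.
move=> S0 SL.
pose Q (L : set V) := (forall a x y, L x -> L y -> L (a *: x + y)) /\
  (forall x, L x -> S x -> x = 0).
have [|L [[LL LS] Lmax]] := @Zorn_bigcup V Q.
  move=> F FQ Ftot; split=> [a x y [X FX Xx] [Y FY Yy]|x [X FX Xx]]; last first.
    exact: (FQ _ FX).2.
  have [XY|YX] := Ftot _ _ FX FY.
    by exists Y => //; apply: (FQ _ FY).1 => //; exact: XY.
  by exists X => //; apply: (FQ _ FX).1 => //; exact: YX.
have SN x : S x -> S (- x).
  by move=> Sx; have := SL (-1) _ _ Sx S0; rewrite addr0 scaleN1r.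
(* By maximality, adding [v] to [L] must create a nonzero intersection with [S],
   unless [v] is in [L] already; the case [v = 0] shows that [L] is not empty. *)
have extend v : (forall a l, L l \/ l = 0 -> S (a *: v + l) -> a *: v + l = 0) -> L v.
  move=> vS; pose B : set V := fun x => exists a l, (L l \/ l = 0) /\ x = a *: v + l.
  have LB : (L `<=` B)%classic.
    by move=> l Ll; exists 0, l; split; [left|rewrite scale0r add0r].
  have Bv : B v by exists 1, 0; split; [right|rewrite scale1r addr0].
  apply: contrapT => Lv; apply: (Lmax B).
    by split=> // BL; apply: Lv; exact: BL.
  split=> [a x y [b [l [Ll ->]]] [c [l' [Ll' ->]]]|x [a [l [Ll ->]]]]; last exact: vS.
  exists (a * b + c), (a *: l + l'); split; last first.
    by rewrite scalerDr scalerA scalerDl addrACA.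
  case: Ll => [Ll|->]; case: Ll' => [Ll'|->].
  - by left; exact: LL.
  - left; rewrite addr0.
    have L0 : L 0 by have := LL (-1) _ _ Ll Ll; rewrite scaleN1r addNr.
    by have := LL a _ _ Ll L0; rewrite addr0.
  - by left; rewrite scaler0 add0r.
  - by right; rewrite scaler0 addr0.
have L0 : L 0.
  apply: extend => a l [Ll|->]; rewrite scaler0 add0r // => Sl; exact: LS.
have dec v : exists s, S s /\ L (v - s).
  apply: contrapT => nv; apply: (nv); exists 0; split=> //; rewrite subr0.
  apply: extend => a l Ll Sal.
  have {}Ll : L l by case: Ll => // ->.
  have [a0|a0] := eqVneq a 0.
    by move: Sal; rewrite a0 scale0r add0r => Sl; exact: LS.
  case: nv; exists (a^-1 *: (a *: v + l)); split.
    by have := SL a^-1 _ _ Sal S0; rewrite addr0.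
  rewrite scalerDr scalerA mulVf // scale1r opprD addrA subrr add0r -scaleNr.
  by have := LL (- a^-1) _ _ Ll L0; rewrite addr0.
have /choice[p pP] := dec.
have pU v s : S s -> L (v - s) -> p v = s.
  move=> Ss Ls; apply/eqP; rewrite -subr_eq0; apply/eqP; apply: LS.
    have := LL (-1) _ _ (pP v).2 Ls; rewrite scaleN1r opprB addrA subrK.
    by [].
  by have := SL 1 _ _ (pP v).1 (SN _ Ss); rewrite scale1r.
have [|p' p'E] := @linear_pack V p.
  move=> a x y; apply: pU; first by apply: SL; [exact: (pP x).1|exact: (pP y).1].
  have := LL a _ _ (pP x).2 (pP y).2.
  by rewrite scalerBr opprD addrACA.
exists p'; split=> x; rewrite p'E; first exact: (pP x).1.
by move=> Sx; apply: pU => //; rewrite subrr.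
Qed.

(** With a projection [p] onto the kernel of [d] and a projection [r] onto its
    image, [g y] is the preimage of [r y] killed by [p]. *)
Lemma generalized_inverse (d : {linear V -> V}) :
  exists g : {linear V -> V}, forall x, d (g (d x)) = d x.
Proof.
have [||p [dp pk]] := @projection_exists (fun x => d x = 0).
- exact: linear0.
- by move=> a x y dx dy; rewrite linearP dx dy scaler0 addr0.
have [||r [rd rk]] := @projection_exists (fun y => exists x, d x = y).
- by exists 0; exact: linear0.
- by move=> a _ _ [x <-] [y <-]; exists (a *: x + y); exact: linearP.
have /choice[q qP] := rd.
have [|g gE] := @linear_pack V (fun y => q y - p (q y)).
  move=> a x y.
  have k : p (q (a *: x + y) - (a *: q x + q y)) = q (a *: x + y) - (a *: q x + q y).
    by apply: pk; rewrite linearB linearP /= !qP linearP subrr.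
  move/eqP: k; rewrite linearB linearP subr_eq => /eqP ->.
  rewrite scalerBr [RHS]addrACA -opprD [- (_ + (_ *: p _ + _))]opprD opprB addrA.
  by rewrite [q _ + _]addrC subrK.
exists g => x; rewrite gE linearB /= dp subr0 qP.
by apply: rk; exists x.
Qed.

End Projection.

Section Contraction.
Variables (K : fieldType) (H : gspace K).

Lemma lin_gpr (H' : gspace K) k (t : {linear H -> H'}) j x :
  (forall i y, homog i y -> homog (i + k) (t y)) ->
  t (gpr H j x) = gpr H' (j + k) (t x).
Proof.
move=> td; have [s us sx] := gpr_sum x; rewrite [in RHS]sx !linear_sum /=.
have -> : gpr H j x = \sum_(i <- s) gpr H j (gpr H i x) by rewrite {1}sx linear_sum.
rewrite linear_sum; apply: eq_bigr => i _.
have hi : homog i (gpr H i x) by rewrite /homog gpr_id.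
have [->|ji] := eqVneq j i; first by rewrite gpr_id (eqP (td _ _ hi)).
rewrite gpr_orth // linear0 -(eqP (td _ _ hi)) gpr_orth //.
by rewrite (inj_eq (addIr k)).
Qed.

(** The component of degree -1 of a generalized inverse of [d] is again a
    generalized inverse, because [d] has degree 1. *)
Lemma graded_inverse (d : {linear H -> H}) :
  (forall k x, homog k x -> homog (k + 1) (d x)) ->
  exists g : {linear H -> H}, (forall k x, homog k x -> homog (k - 1) (g x)) /\
    forall x, d (g (d x)) = d x.
Proof.
move=> dd; have [g0 g0P] := generalized_inverse d.
pose g x := \sum_(k \in [set: int]) gpr H (k - 1) (g0 (gpr H k x)).
have gE s x : uniq s -> (forall k, k \notin s -> gpr H k x = 0) ->
    g x = \sum_(k <- s) gpr H (k - 1) (g0 (gpr H k x)).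
  by move=> us h; apply: fsbig_seq_supp => // k /h->; rewrite !linear0.
have gh k x : homog k x -> g x = gpr H (k - 1) (g0 x).
  move=> hx; rewrite (gE [:: k]) // ?big_seq1 ?(eqP hx) // => j.
  by rewrite inE => jk; rewrite -(eqP hx) gpr_orth.
have [|g' g'E] := @linear_pack _ _ _ g.
  move=> a x y; have [s us hs] := gpr_supp x; have [t ut ht] := gpr_supp y.
  have hr k : k \notin undup (s ++ t) -> gpr H k x = 0 /\ gpr H k y = 0.
    rewrite mem_undup mem_cat negb_or => /andP[ds dt].
    by split; [exact: hs | exact: ht].
  rewrite !(gE (undup (s ++ t))) ?undup_uniq // => [|k /hr[]//|k /hr[]//|k /hr[ex ey]].
    by rewrite scaler_sumr -big_split; apply: eq_bigr => k _; rewrite !linearP.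
  by rewrite linearP ex ey scaler0 addr0.
exists g'; split=> [k x hx|x]; first by rewrite g'E (gh _ _ hx) /homog gpr_id.
have [s _ ->] := gpr_sum x; rewrite !linear_sum; apply: eq_bigr => k _.
have hk : homog k (gpr H k x) by rewrite /homog gpr_id.
rewrite g'E (gh _ _ (dd _ _ hk)) addrK (lin_gpr _ _ dd) g0P.
exact/eqP/dd.
Qed.

(** From d g d = d one gets h = g d g (1 - g d) with d h d = d and h h = 0: the
    projection d g onto the boundaries is made to vanish on the complement
    of the cycles that g d projects onto. These two identities make
    1 - d h - h d a projection. *)
Lemma contraction_exists (d : {linear H -> H}) :
  (forall k x, homog k x -> homog (k + 1) (d x)) -> (forall x, d (d x) = 0) ->
  exists h P : {linear H -> H}, contraction d h P.
Proof.
move=> dd d2; have [g [gd gP]] := graded_inverse dd.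
have [h hE] : exists h : {linear H -> H}, forall x, h x = g (d (g (x - g (d x)))).
  by exists (g \o d \o g \o (idfun \- (g \o d))).
have dhd x : d (h (d x)) = d x.
  by rewrite hE d2 linear0 subr0 !gP.
have hh x : h (h x) = 0.
  by rewrite [h x]hE hE gP subrr !linear0.
have [P PE] : exists P : {linear H -> H}, forall x, P x = x - d (h x) - h (d x).
  by exists (idfun \- (d \o h) \- (h \o d)).
have Pd x : P (d x) = 0 by rewrite PE dhd d2 linear0 subr0 subrr.
have dP x : d (P x) = 0 by rewrite PE !linearB /= d2 subr0 dhd subrr.
have hd k x : homog k x -> homog (k - 1) (h x).
  move=> kx; rewrite hE; have -> : k - 1 = k - 1 + 1 - 1 by rewrite subrK.
  apply/gd/dd/gd/homogD => //; apply: homogN.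
  by rewrite -[k](addrK 1); exact/gd/dd.
exists h, P; split=> //.
- move=> k x kx; rewrite PE; apply: homogD; first apply: homogD => //.
    by apply: homogN; rewrite -[k](subrK 1); exact/dd/hd.
  by apply: homogN; rewrite -[k](addrK 1); exact/hd/dd.
- move=> x; rewrite [P (P x)]PE dP linear0 subr0.
  suff -> : d (h (P x)) = 0 by rewrite subr0.
  by rewrite PE !linearB /= dhd hh linear0 subr0 subrr.
- by move=> x; rewrite PE !opprB [RHS]addrC -addrA subrK addrC.
Qed.

End Contraction.

(** * Transfer of the operations *)

Section LinearChange.
Variables (K : fieldType) (H H' H'' : gspace K).

Lemma has_degree_comp e k (g : H' -> H'') (phi : seq H -> H') :
  (forall j x, homog j x -> homog (j + k) (g x)) ->
  has_degree e phi -> has_degree (e + k) (fun w => g (phi w)).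
Proof. by move=> gd pd ds w w0 dw; rewrite addrA; apply: gd; exact: pd. Qed.

Lemma has_degree_map e (g : H -> H') (phi : seq H' -> H'') :
  (forall j x, homog j x -> homog j (g x)) ->
  has_degree e phi -> has_degree e (fun w => phi (map g w)).
Proof.
move=> gd pd ds w w0 dw; apply: pd; first by case: w w0 {dw}.
by elim: ds w dw {w0} => [|k ds ih] [|x w] //= /andP[/gd-> /ih->].
Qed.

End LinearChange.

Section SingleLetter.
Variables (K : fieldType) (H : gspace K).

Definition on_letters (g : H -> H) (w : seq H) : H := if w is [:: x] then g x else 0.

Lemma on_letters_multilinear (g : {linear H -> H}) : multilinear (on_letters g).
Proof.
move=> [|z [|z' s]] [|y t] a x x' /=; rewrite ?linearP ?scaler0 ?addr0 //.
Qed.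

Lemma on_letters_degree (g : {linear H -> H}) e :
  (forall k x, homog k x -> homog (k + e) (g x)) -> has_degree e (on_letters g).
Proof.
move=> gd [|k ds] [|x [|y w]] //= _; last by rewrite homog0.
by case: ds => [|j ds]; rewrite ?andbF // andbT big_seq1; exact: gd.
Qed.

End SingleLetter.

Section Transfer.
Variables (K : fieldType) (H : gspace K) (m : seq H -> H).
Variables (d h P : {linear H -> H}).
Hypotheses (m0 : m [::] = 0) (mL : multilinear m) (md : has_degree 1 m).
Hypothesis m2 : forall w, dpull m m w = 0.
Hypotheses (m1 : forall x, m [:: x] = d x) (dhP : contraction d h P).
Local Notation eps := (@parity K H).

Lemma m1E : (fun x => m [:: x]) = d.
Proof. exact/funext. Qed.

Lemma d_degree k x : homog k x -> homog (k + 1) (d x).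
Proof.
move=> kx; have := md (ds := [:: k]) (w := [:: x]) isT.
by rewrite m1 big_seq1; apply; rewrite /= kx.
Qed.

Lemma d_parity x : d (eps x) = - eps (d x).
Proof. by rewrite (lin_parity x d_degree) expr1z scaleN1r. Qed.

Lemma h_parity x : h (eps x) = - eps (h x).
Proof. by rewrite (lin_parity x (contr_h dhP)) exprN1 invrN1 scaleN1r. Qed.

Lemma P_parity x : P (eps x) = eps (P x).
Proof.
rewrite (@lin_parity _ _ _ 0) ?expr0z ?scale1r // => k y ky.
by rewrite addr0; exact: contr_P dhP _ _ ky.
Qed.

(** The induction hypothesis of the transfer: [f] has the identity as linear
    part and is a morphism on words of length at most [n], and the operations
    [m'] of arity at least two factor through [P] on both sides. *)
Record transferred (n : nat) (f m' : seq H -> H) : Prop := {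
  tr_fL : multilinear f;
  tr_mL : multilinear m';
  tr_fd : has_degree 0 f;
  tr_md : has_degree 1 m';
  tr_f0 : f [::] = 0;
  tr_m0 : m' [::] = 0;
  tr_f1 : forall x, f [:: x] = x;
  tr_m1 : forall x, m' [:: x] = d x;
  tr_Pm : forall w, (1 < size w)%N -> P (m' w) = m' w;
  tr_mP : forall w, (1 < size w)%N -> m' (map P w) = m' w;
  tr_defect : forall w, (size w <= n)%N -> defect m m' f w = 0
}.

Lemma defect_multilinear (f m' : seq H -> H) : multilinear f -> multilinear m' ->
  multilinear (defect m m' f).
Proof.
move=> fL mL'; apply: mlin_add; first exact: dpull_multilinear.
by apply: mlin_opp; exact: fpull_multilinear.
Qed.

Lemma defect_degree (f m' : seq H -> H) :
  multilinear f -> has_degree 0 f -> has_degree 1 m' ->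
  has_degree 1 (defect m m' f).
Proof.
move=> fL fd md'; apply: has_degreeD; last first.
  by apply: has_degreeN; exact: has_degree_fpull.
by rewrite -[1]add0r; exact: has_degree_dpull.
Qed.

(** The leading part of the identity obtained by applying the square-zero
    coderivation to the defect: its boundary is the failure of the operations
    [m'] to square to zero. *)
Lemma defect_boundary (f m' : seq H -> H) v :
  multilinear f -> multilinear m' -> has_degree 0 f -> f [::] = 0 ->
  (forall x, f [:: x] = x) -> (forall x, m' [:: x] = d x) ->
  (forall s, (size s < size v)%N -> defect m m' f s = 0) ->
  (forall s, (size s < size v)%N -> dpull m' m' s = 0) ->
  ins eps d (defect m m' f) v + d (defect m m' f v) = - dpull m' m' v.
Proof.
move=> fL mL' fd f0 f1 m1' U0 O0; set U := defect m m' f.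
have UL : multilinear U by exact: defect_multilinear.
have mO : odd_op m by exact: odd_op_degree.
have E := dpull_fpull_low mL' (even_map_degree fL fd f0) U0.
have F : dpull m (fpull f m') v = - ins eps d U v.
  rewrite -m1E -(dpull_low m0 UL U0).
  have -> : fpull f m' = fun w => dpull m f w - U w.
    by apply/funext => w; rewrite /U /defect opprB addrC subrK.
  transitivity (dpull m (dpull m f) v - dpull m U v).
    by rewrite /dpull -sumrB; apply: eq_bigr => c _; rewrite -sumrB.
  rewrite dpull_dpull // big1 ?sub0r // => c _; rewrite big1 // => e _.
  by rewrite m2 mlin0.
move: E; rewrite F fpull_low // m1' -/U (eq_map f1) map_id => E.
by rewrite -[ins _ _ _ _]opprK E opprD addrNK.
Qed.

(** The coalgebra map of [f] is injective, so that [m'] squares to zero as far as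
    [f] is a morphism. *)
Lemma transferred_square (f m' : seq H -> H) n :
  multilinear f -> multilinear m' -> has_degree 0 f -> f [::] = 0 ->
  (forall x, f [:: x] = x) -> (forall x, m' [:: x] = d x) ->
  (forall s, (size s <= n)%N -> defect m m' f s = 0) ->
  forall v, (size v <= n)%N -> dpull m' m' v = 0.
Proof.
move=> fL mL' fd f0 f1 m1' U0 v.
have [k] := ubnP (size v); elim: k v => // k ih v vk vn.
have B := defect_boundary fL mL' fd f0 f1 m1'.
apply/eqP; rewrite -oppr_eq0 -B; last first.
- by move=> s sv; apply: ih; lia.
- by move=> s sv; apply: U0; lia.
rewrite U0 // linear0 addr0 ins0 // => u uv; apply: U0; lia.
Qed.

(** One more arity: in arity n+1 the operation becomes the part [P U P] of the
    defect [U], and [f] the homotopy that contracts the rest of it. *)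
Definition step (n : nat) (q : (seq H -> H) * (seq H -> H)) :=
  let U := defect m q.2 q.1 in
  (fun w => if size w == n.+1 then h (U w) - P (ins (eps \o P) h U w) else q.1 w,
   fun w => if size w == n.+1 then P (U (map P w)) else q.2 w).

Section Step.
Variables (n : nat) (f m' : seq H -> H).
Hypotheses (n0 : (0 < n)%N) (tr : transferred n f m').
Hypothesis f_supp : forall w, (n < size w)%N -> f w = 0.
Hypothesis m_supp : forall w, (n < size w)%N -> m' w = 0.
Let U := defect m m' f.
Let fL := tr_fL tr.
Let mL' := tr_mL tr.
Let UL : multilinear U := defect_multilinear fL mL'.

Lemma U_small s : (size s < n.+1)%N -> U s = 0.
Proof. exact: tr_defect tr s. Qed.

(** In arity n+1 the square of [m'] is a sum of compositions of operations of
    arities between two and n, all of which factor through [P]. *)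
Lemma step_square w : size w = n.+1 -> dpull m' m' w = P (dpull m' m' (map P w)).
Proof.
move=> wn; rewrite /dpull cuts_map big_map linear_sum.
under [RHS]eq_bigr => c _.
  rewrite cuts_map big_map linear_sum; over.
apply: (eq_cuts (F := fun a r => \sum_(e <- cuts r) m' (map eps a ++ m' e.1 :: e.2))
  (G := fun a r => \sum_(e <- cuts r)
     P (m' (map eps (map P a) ++ m' (map P e.1) :: map P e.2)))) => a r wE.
apply: (eq_cuts (F := fun b c => m' (map eps a ++ m' b :: c))
  (G := fun b c => P (m' (map eps (map P a) ++ m' (map P b) :: map P c)))) => b c rE.
have Pa : map eps (map P a) = map P (map eps a).
  by rewrite -!map_comp; apply: eq_map => x /=; rewrite P_parity.
case: (ltngtP (size b) 1%N) => bs.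
- by case: b bs {rE} => //= _; rewrite (tr_m0 tr) !(mlin0 mL') // linear0.
- have [bn|bn] := ltnP n (size b).
    by rewrite !(m_supp (w := b), m_supp (w := map P b)) ?size_map // !(mlin0 mL') linear0.
  rewrite (tr_mP tr) // Pa (tr_Pm tr); last by rewrite size_cat !size_map /= !size_map; lia.
  rewrite -[LHS](tr_mP tr); last by rewrite size_cat !size_map /=; lia.
  by rewrite map_cat /= (tr_Pm tr).
- have z u x v : (size u + size v = n)%N -> m' (u ++ x :: v) = 0.
    by move=> uv; apply: m_supp; rewrite size_cat /=; lia.
  by rewrite !z ?linear0 // !size_map; apply: succn_inj; rewrite -wn wE rE bs addnCA.
Qed.

(** The boundary of the defect is, up to sign, the square of [m'], hence equal to
    its part over the image of [P]; but that part of a boundary is zero, as [d]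
    vanishes before and after [P]. *)
Lemma U_closed w : size w = n.+1 -> ins eps d U w = - d (U w).
Proof.
move=> wn; have sq := transferred_square fL mL' (tr_fd tr) (tr_f0 tr)
  (tr_f1 tr) (tr_m1 tr) (tr_defect tr).
have B v : size v = n.+1 -> ins eps d U v + d (U v) = - dpull m' m' v.
  move=> vn; apply: defect_boundary => //; try by case: tr.
    by rewrite vn; exact: U_small.
  by rewrite vn => s; exact: sq.
have O0 : dpull m' m' w = 0.
  rewrite step_square // -[dpull _ _ _]opprK -B ?size_map //.
  rewrite ins_map0 //; last exact: contr_dP dhP.
  by rewrite add0r linearN /= (contr_Pd dhP) oppr0.
by apply/eqP; rewrite -addr_eq0 B // O0 oppr0.
Qed.

Lemma step_low w : (size w <= n)%N ->
  (step n (f, m')).1 w = f w /\ (step n (f, m')).2 w = m' w.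
Proof. by move=> wn; rewrite /step /= ltn_eqF. Qed.

Lemma contraction_cancel x y z :
  x + (h (- d x) - P (x - y + d z)) - d (h x - P z) - P y = 0.
Proof.
rewrite (raddfN h) (raddfD P) (raddfB P) (raddfB d) /= (contr_Pd dhP) (contr_dP dhP).
rewrite addr0 subr0 -{1}[x](subrK (P x)) -(contr_dh dhP).
rewrite opprB [- h _ + _]addrC addrA [P y - _]addrC addrA addrK.
by rewrite [_ + _ + P y]addrAC addrK [_ + P y - _]addrAC subrr add0r subrr.
Qed.

(** The contraction of Hom(H^(n+1), H) induced by [h] writes the cocycle [U] as the
    boundary of the new component of [f] plus its part over the image of [P],
    the new operation. *)
Lemma step_cancel w : size w = n.+1 ->
  U w + ins eps d (fun u => h (U u) - P (ins (eps \o P) h U u)) w -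
  d (h (U w) - P (ins (eps \o P) h U w)) - P (U (map P w)) = 0.
Proof.
move=> wn; set B := ins (eps \o P) h U.
have -> : ins eps d (fun u => h (U u) - P (B u)) w =
    h (ins eps d U w) - P (ins eps d B w).
  rewrite (insD eps d (fun u => h (U u)) (fun u => - P (B u))).
  rewrite (ins_comp h) -(ins_comp P).
  by rewrite -(ins_comp (-%R : {additive H -> H})).
have := ins_homotopy w UL (@parityK K H) P_parity d_parity h_parity
  (contr_Pd dhP) (contr_dP dhP) (contr_dh dhP).
have -> : ins (eps \o P) h (ins eps d U) w = - d (B w).
  rewrite -(ins_comp d) -(ins_comp (-%R : {additive H -> H})).
  by apply: eq_ins => u uw; rewrite U_closed // uw.
rewrite -/B => /eqP; rewrite subr_eq => /eqP ->.
rewrite U_closed //; exact: contraction_cancel.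
Qed.

Lemma step_fL : multilinear (step n (f, m')).1.
Proof.
apply: (mlin_if (fun k => k == n.+1)) fL; apply: mlin_add.
  by apply: (mlin_comp UL (g := h)); exact: linearP.
apply: mlin_opp; apply: (@mlin_comp _ _ _ (ins (eps \o P) h U) _ _ P); last exact: linearP.
exact: (ins_multilinear (eps \o P : {linear H -> H}) h UL).
Qed.

Lemma step_mL : multilinear (step n (f, m')).2.
Proof.
apply: (mlin_if (fun k => k == n.+1)) mL'.
by apply: (mlin_comp (mlin_map UL P) (g := P)); exact: linearP.
Qed.

Lemma step_defect w : (size w <= n.+1)%N ->
  defect m (step n (f, m')).2 (step n (f, m')).1 w = 0.
Proof.
rewrite leq_eqVlt => /predU1P[wn|wn]; last first.
  rewrite -(tr_defect tr (w := w)) // /defect; congr (_ - _).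
    apply: eq_dpull => //; first exact: step_fL.
    by move=> s sw; apply: (step_low _).1; lia.
  by apply: eq_fpull => s sw; [apply: (step_low _).1 | apply: (step_low _).2]; lia.
set f' := (step _ _).1; set m'' := (step _ _).2.
have f'L : multilinear f' by exact: step_fL.
have fE s : (size s < n.+1)%N -> f' s = f s by move=> sn; apply: (step_low _).1.
have mE s : (size s < n.+1)%N -> m'' s = m' s by move=> sn; apply: (step_low _).2.
have f'w u : size u = size w -> f' u = h (U u) - P (ins (eps \o P) h U u).
  by move=> uw; rewrite /f' /step /= uw wn eqxx.
have f0 u : size u = size w -> f u = 0 by move=> uw; rewrite f_supp // uw wn.
have dE : dpull m f' w = dpull m f w +
    ins eps d (fun u => h (U u) - P (ins (eps \o P) h U u)) w.
  apply/eqP; rewrite addrC -subr_eq; apply/eqP.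
  transitivity (dpull m (fun u => f' u - f u) w).
    by rewrite /dpull -sumrB; apply: eq_bigr => c _; rewrite -sumrB.
  rewrite dpull_low //; first last.
  - by move=> s; rewrite wn => /fE->; rewrite subrr.
  - by apply: mlin_add => //; exact: mlin_opp.
  by rewrite m1E; apply: eq_ins => u uw; rewrite f'w // f0 // subr0.
have pE : fpull f' m'' w = fpull f m' w + d (f' w) + P (U (map P w)).
  transitivity (fpull f' m' w + fpull f' (fun u => m'' u - m' u) w).
    rewrite /fpull -big_split; apply: eq_bigr => p _.
    by rewrite /= addrC subrK.
  rewrite [fpull f' (fun u => _ - _) w]fpull_low; last first.
    by move=> s; rewrite wn /= => /mE->; rewrite subrr.
  have -> : map (fun x => f' [:: x]) w = w.
    rewrite -[RHS]map_id; apply: eq_map => x /=.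
    by rewrite fE ?(tr_f1 tr).
  rewrite [m' w]m_supp ?wn // subr0 /m'' /step /= wn eqxx; congr (_ + _).
  have w0 : w != [::] by rewrite -size_eq0 wn.
  have top := @fpull_top K H H H f' f m' w w0.
  apply/eqP; rewrite -subr_eq -(tr_m1 tr) top; last by rewrite wn.
  by rewrite f0 // (tr_m1 tr) linear0 subr0.
rewrite /defect dE pE -[RHS](step_cancel wn) -f'w // /U /defect.
by rewrite !opprD !addrA; congr (_ - _ - _); rewrite addrAC.
Qed.

Lemma transferred_step : transferred n.+1 (step n (f, m')).1 (step n (f, m')).2.
Proof.
have Ud : has_degree 1 U by exact: defect_degree (tr_fL tr) (tr_fd tr) (tr_md tr).
have Pd k x : homog k x -> homog (k + 0) (P x).
  by rewrite addr0; exact: contr_P dhP k x.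
have hUd : has_degree 0 (fun w => h (U w)).
  by rewrite -(subrr 1); apply: has_degree_comp Ud; exact: contr_h dhP.
have BUd : has_degree 0 (fun w => P (ins (eps \o P) h U w)).
  rewrite -[0]addr0 -{1}(subrr 1); apply: has_degree_comp => //.
  apply: has_degree_ins => //; last exact: contr_h dhP.
  by move=> k x kx /=; apply/homog_parity; exact: contr_P dhP k x kx.
split.
- exact: step_fL.
- exact: step_mL.
- apply: (has_degree_if (fun k => k == n.+1)); last exact: tr_fd tr.
  by apply: has_degreeD => //; exact: has_degreeN.
- apply: (has_degree_if (fun k => k == n.+1)); last exact: tr_md tr.
  rewrite -[1]addr0; apply: (has_degree_comp Pd).
  by apply: has_degree_map Ud; exact: contr_P dhP.
- by rewrite (step_low _).1 // (tr_f0 tr).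
- by rewrite (step_low _).2 // (tr_m0 tr).
- by move=> x; rewrite (step_low _).1 // (tr_f1 tr).
- by move=> x; rewrite (step_low _).2 // (tr_m1 tr).
- move=> w w1; rewrite /step /=; case: ifP => _; last exact: tr_Pm tr w w1.
  exact: contr_PP dhP _.
- move=> w w1; rewrite /step /= size_map; case: ifP => _; last exact: tr_mP tr w w1.
  by rewrite -map_comp (eq_map (contr_PP dhP)).
- exact: step_defect.
Qed.

Lemma step_supp w : (n.+1 < size w)%N ->
  (step n (f, m')).1 w = 0 /\ (step n (f, m')).2 w = 0.
Proof.
by move=> wn; rewrite /step /= gtn_eqF // f_supp ?m_supp //; exact: ltnW.
Qed.

End Step.

Fixpoint transfer n : (seq H -> H) * (seq H -> H) :=
  if n is k.+1 then step k.+1 (transfer k) else (on_letters idfun, on_letters d).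

Lemma transferP n :
  [/\ transferred n.+1 (transfer n).1 (transfer n).2,
      forall w, (n.+1 < size w)%N -> (transfer n).1 w = 0 &
      forall w, (n.+1 < size w)%N -> (transfer n).2 w = 0].
Proof.
elim: n => [|n] /=; last first.
  case: (transfer n) => f m' /= [tr fs ms]; split.
  - exact: transferred_step.
  - by move=> w wn; apply: (step_supp fs ms wn).1.
  - by move=> w wn; apply: (step_supp fs ms wn).2.
have fL := on_letters_multilinear (idfun : {linear H -> H}).
split; [|by case=> [|x [|y w]]|by case=> [|x [|y w]]].
split=> //; try by [case=> [|x [|y w]]].
- exact: on_letters_multilinear.
- by apply: (@on_letters_degree _ _ idfun) => k x; rewrite addr0.
- by apply: on_letters_degree; exact: d_degree.
- by case=> [|x [|y w]] //; rewrite linear0.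
move=> w w1; rewrite /defect dpull_low //; last by case: w w1 => [|x [|y w]] // _ [].
rewrite fpull_low; last by case: w w1 => [|x [|y w]] // _ [].
by case: w w1 => [|x [|y w]] //= _; rewrite ?m1 ?addr0 subrr.
Qed.

Lemma transfer_stable k l w : (size w <= k.+1)%N -> (k <= l)%N ->
  (transfer l).1 w = (transfer k).1 w /\ (transfer l).2 w = (transfer k).2 w.
Proof.
move=> wk; elim: l => [|l ih]; first by rewrite leqn0 => /eqP->.
rewrite leq_eqVlt => /predU1P[<- //|kl]; have [<- <-] := ih kl.
by rewrite /= ltn_eqF // ltnS (leq_trans wk).
Qed.

(** The steps stabilize in each arity. *)
Lemma transfer_exists :
  exists f m' : seq H -> H, forall n, transferred n f m'.
Proof.
pose f w := (transfer (size w)).1 w; pose m' w := (transfer (size w)).2 w.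
have E k w : (size w <= k.+1)%N -> f w = (transfer k).1 w /\ m' w = (transfer k).2 w.
  move=> wk; rewrite /f /m'; have [kw|/ltnW kw] := leqP k (size w).
    exact: transfer_stable.
  by have [-> ->] := transfer_stable (leqnSn (size w)) kw.
have tr k : transferred k.+1 (transfer k).1 (transfer k).2 by case: (transferP k).
have fL : multilinear f.
  by move=> s t a x y; have := tr_fL (tr (size (s ++ x :: t))) s t a x y;
    rewrite /f !size_cat.
have mL' : multilinear m'.
  by move=> s t a x y; have := tr_mL (tr (size (s ++ x :: t))) s t a x y;
    rewrite /m' !size_cat.
exists f, m' => n; split=> //.
- by move=> ds w; exact: tr_fd (tr (size w)) ds w.
- by move=> ds w; exact: tr_md (tr (size w)) ds w.
- by move=> w; exact: tr_Pm (tr (size w)) w.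
- by move=> w; rewrite /m' size_map; exact: tr_mP (tr (size w)) w.
move=> w _; rewrite -(tr_defect (tr (size w)) (leqnSn _)) /defect; congr (_ - _).
  apply: eq_dpull => //; first exact: tr_fL (tr _).
  by move=> s sw; apply: (E (size w) s _).1; lia.
by apply: eq_fpull => s sw; [apply: (E (size w) s _).1 | apply: (E (size w) s _).2]; lia.
Qed.

End Transfer.

(** * The image of an idempotent as an algebra *)

Section Retract.
Variables (K : fieldType) (H : gspace K) (E : {linear H -> H}).

Definition fixed : {pred H} := [pred x | E x == x].

Lemma fixed_submod : submod_closed fixed.
Proof.
split=> [|a x y]; first by rewrite inE linear0.
by rewrite !inE linearP => /eqP-> /eqP->.
Qed.

HB.instance Definition _ := GRing.isSubmodClosed.Build K H fixed fixed_submod.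

Definition fixed_space := {x : H | x \in fixed}.

HB.instance Definition _ := SubChoice.on fixed_space.
HB.instance Definition _ := [SubChoice_isSubLmodule of fixed_space by <:].

Hypotheses (EE : forall x, E (E x) = E x).
Hypothesis Ed : forall k x, homog k x -> homog k (E x).

Lemma retract_exists : exists r : {linear H -> fixed_space}, forall x, val (r x) = E x.
Proof.
have Ein x : E x \in fixed by rewrite inE EE.
pose r x : fixed_space := Sub (E x) (Ein x).
have rE x : val (r x) = E x by rewrite SubK.
have [|r' r'E] := @linear_pack K H fixed_space r.
  by move=> a x y; apply: val_inj; rewrite linearP !rE linearP.
by exists r' => x; rewrite r'E.
Qed.

Lemma retract_gspace : exists (G : gspace K) (i : {linear G -> H}) (r : {linear H -> G}),
  [/\ forall x, i (r x) = E x, forall b, r (i b) = b &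
      forall k b, homog k b = homog k (i b)].
Proof.
have [r rE] := retract_exists.
pose i : {linear fixed_space -> H} := \val.
have Ei b : E (i b) = i b by apply/eqP; exact: (valP b).
have iI : injective i by exact: val_inj.
have ri b : r (i b) = b by apply: iI; rewrite [LHS]rE Ei.
pose pr k : {linear fixed_space -> fixed_space} := r \o gpr H k \o i.
have prE k b : i (pr k b) = gpr H k (i b).
  rewrite [LHS]rE -[in RHS]Ei -[k in RHS]addr0.
  by rewrite -(lin_gpr (k := 0)) // => j y; rewrite addr0; exact: Ed.
have pr_id k b : pr k (pr k b) = pr k b by apply: iI; rewrite !prE gpr_id.
have pr_orth k l b : k != l -> pr k (pr l b) = 0.
  by move=> kl; apply: iI; rewrite !prE gpr_orth // linear0.
have pr_sum b : exists2 s : seq int, uniq s & b = \sum_(k <- s) pr k b.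
  have [s us sE] := gpr_sum (i b); exists s => //; apply: iI.
  by rewrite linear_sum [LHS]sE; apply: eq_bigr => k _; rewrite prE.
exists (@GSpace K fixed_space pr pr_id pr_orth pr_sum), i, r; split=> //.
by move=> k b; rewrite /homog /= -(inj_eq iI) prE.
Qed.

Lemma retract_algebra (m : seq H -> H) :
  multilinear m -> has_degree 1 m -> m [::] = 0 ->
  (forall w, dpull m m w = 0) ->
  (forall w, E (m (map E w)) = m (map E w)) ->
  exists (B : ainf_algebra K) (i : {linear B -> H}) (r : {linear H -> B}),
  [/\ forall x, i (r x) = E x, forall b, r (i b) = b,
      forall k b, homog k b = homog k (i b) &
      forall w, aop w = r (m (map i w))].
Proof.
move=> mL md m0 m2 mE.
have [G [i [r [ir ri hi]]]] := retract_gspace.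
pose op w := r (m (map i w)).
have iop w : i (op w) = m (map i w).
  rewrite ir; have -> : map i w = map E (map i w); last exact: mE.
  by rewrite -map_comp; apply: eq_map => b /=; rewrite -ir ri.
have opL : multilinear op.
  by apply: (mlin_comp (mlin_map mL i) (g := r)); exact: linearP.
have opd : has_degree 1 op.
  move=> ds w w0 dw; rewrite hi iop.
  have mid : has_degree 1 (fun w => m (map i w)).
    by apply: has_degree_map md => k b; rewrite hi.
  exact: mid.
have op0 : op [::] = 0 by rewrite /op m0 linear0.
have rop : reduced op = op by apply/funext => -[].
have ipar b : i (parity b) = parity (i b).
  rewrite (@lin_parity _ _ _ 0) ?expr0z ?scale1r // => k y.
  by rewrite addr0 hi.
have op2 : ainf_relations op.
  apply: ainf_relations_dpull => // w; rewrite rop.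
  have i0 : i (dpull op op w) = 0; last by rewrite -(ri (dpull _ _ w)) i0 linear0.
  rewrite -(m2 (map i w)) /dpull cuts_map big_map linear_sum.
  apply: eq_bigr => c _; rewrite cuts_map big_map linear_sum.
  apply: eq_bigr => d _; rewrite iop map_cat /= iop; congr (m (_ ++ _)).
  by rewrite -!map_comp; apply: eq_map => b /=; rewrite ipar.
by exists (AInfAlgebra opL opd op2), i, r; split.
Qed.

End Retract.

(** * The decomposition *)

Lemma on_letters_square (K : fieldType) (H : gspace K) (d : {linear H -> H}) w :
  (forall x, d (d x) = 0) -> dpull (on_letters d) (on_letters d) w = 0.
Proof.
move=> d2; rewrite /dpull big1 // => c _; rewrite big1 // => e _.
case: c.1 => [|x a] /=; last by case: a.
by case: e.2 => //; case: e.1 => [|x [|y b]] /=; rewrite ?linear0.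
Qed.

(** The isomorphism is the morphism onto the transferred algebra, followed by the
    splitting of the underlying space into the images of [P] and [1 - P]. *)
Theorem ainf_decomposition (K : fieldType) (A : ainf_algebra K) :
  exists M C : ainf_algebra K,
    minimal M /\ linear_contractible C /\ ainf_isomorphic A (dsum M C).
Proof.
pose m := reduced (@aop K A).
have mL : multilinear m by apply: reduced_multilinear; exact: aop_multilinear.
have md : has_degree 1 m by apply: reduced_degree; exact: aop_degree.
have m0 : m [::] = 0 by [].
have m2 w : dpull m m w = 0 by exact: aop_dpull.
have [|d dE] := @linear_pack K A A (fun x => m [:: x]).
  by move=> a x y; exact: (mL [::] [::]).
have m1 x : m [:: x] = d x by rewrite dE.
have d_deg := d_degree md m1.
have d2 x : d (d x) = 0.
  have := m2 [:: x]; rewrite dpull_low //=; last by case=> // _; exact: m0.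
  by rewrite addr0 !m1.
have [h [P dhP]] := contraction_exists d_deg d2.
have [f [m' tr]] := transfer_exists m0 mL md m2 m1 dhP.
have Pd := contr_Pd dhP; have dP := contr_dP dhP; have PP := contr_PP dhP.
have fm : forall w, defect m m' f w = 0.
  by move=> w; exact: tr_defect (tr (size w)) w (leqnn _).
have [fL mL' fd md' f0 m0' f1 m1' Pm mP _] := tr 0%N.
have m2' w : dpull m' m' w = 0.
  exact: (transferred_square m0 mL md m2 m1 fL mL' fd f0 f1 m1'
    (fun s _ => fm s) (leqnn (size w))).
have [Q QE] : exists Q : {linear A -> A}, forall x, Q x = x - P x.
  by exists (idfun \- P).
have Pm' w : P (m' (map P w)) = m' (map P w).
  case: w => [|x [|y w]]; rewrite ?m0' ?linear0 //; last exact: Pm.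
  by rewrite /= m1' dP linear0.
have [M [i [r [ir ri hi opM]]]] := retract_algebra PP (contr_P dhP) mL' md' m0' m2' Pm'.
have QQ x : Q (Q x) = Q x by rewrite !QE linearB /= PP subrr subr0.
have Qdeg k x : homog k x -> homog k (Q x).
  by move=> kx; rewrite QE; apply: homogD => //; apply: homogN; exact: contr_P dhP k x kx.
have Qd w : Q (on_letters d (map Q w)) = on_letters d (map Q w).
  by case: w => [|x [|y w]]; rewrite /= ?linear0 // QE Pd subr0.
have [C [j [s [js sj hj opC]]]] := retract_algebra QQ Qdeg (on_letters_multilinear d)
  (on_letters_degree d_deg) (erefl _) (fun w => on_letters_square w d2) Qd.
have jE b : P (j b) = 0.
  have := js (j b); rewrite sj QE => /esym/eqP.
  by rewrite -subr_eq0 addrAC subrr add0r oppr_eq0 => /eqP.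
have iE b : P (i b) = i b by rewrite -ir ri.
exists M, C; split; [|split; [split|]].
- by move=> x; rewrite opM /= m1' -(ri x) ir dP linear0.
- by move=> [|x [|y w]] //= _; rewrite opC linear0.
- move=> x; rewrite opC /= => sd0.
  have dj : d (j x) = 0.
    by have := congr1 j sd0; rewrite js QE Pd subr0 linear0.
  exists (s (h (j x))); rewrite opC /= js QE -[RHS]sj; apply: (congr1 s).
  rewrite linearB /= dP subr0.
  by have := contr_dh dhP (j x); rewrite dj linear0 addr0 jE subr0.
have [|p pE] := @linear_pack K A (dsum M C) (fun x => (r x, s x)).
  by move=> a x y; rewrite !linearP.
have rM w : aop (map r w) = r (m' w).
  have r0 x : P x = 0 -> r x = 0 by move=> Px; rewrite -(ri (r x)) ir Px linear0.
  rewrite opM -map_comp (eq_map ir).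
  case: w => [|x [|y w]] //; last by rewrite mP.
  by rewrite /= !m1' dP linear0 r0.
have sC w : aop (map s w) = s (m' w).
  have s0 x : P x = x -> s x = 0.
    by move=> Px; rewrite -(sj (s x)) js QE Px subrr linear0.
  rewrite opC -map_comp (eq_map js).
  case: w => [|x [|y w]]; first by rewrite m0'.
    by rewrite /= m1' QE linearB /= dP subr0.
  by rewrite /= linear0 s0 // Pm.
have dsum_p w : reduced (@aop K (dsum M C)) (map p w) = p (m' w).
  case: w => [|x w]; first by rewrite m0' linear0.
  rewrite [LHS]/(dsum_op (map p (x :: w))) /dsum_op -2!map_comp pE -rM -sC.
  by congr (aop _, aop _); apply: eq_map => y /=; rewrite pE.
exists (fun w => p (f w)); split; last first.
  exists (fun u => i u.1 + j u.2) => [x|[u v]].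
    by rewrite f1 pE /= ir js QE addrC subrK.
  rewrite f1 pE; congr pair.
    by rewrite -[LHS]ri ir (linearD P) /= jE addr0 iE ri.
  by rewrite -[LHS]sj js QE (linearD P) /= jE addr0 iE addrAC subrr add0r sj.
have pd k x : homog k x -> homog (k + 0) (p x).
  move=> kx; rewrite addr0 dsum_homog pE /= hi hj ir js QE.
  have kP := contr_P dhP kx.
  by rewrite kP homogD // homogN.
apply: ainf_morphism_defect.
- by apply: (mlin_comp fL (g := p)); exact: linearP.
- by rewrite -[0]addr0; exact: has_degree_comp pd fd.
- by rewrite f0 linear0.
move=> w; transitivity (p (defect m m' f w)); last by rewrite fm linear0.
rewrite /defect linearB; congr (_ - _).
  rewrite /dpull linear_sum; apply: eq_bigr => c _; by rewrite linear_sum.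
rewrite /fpull linear_sum; apply: eq_bigr => q _.
by rewrite -dsum_p -map_comp.
Qed.

Theorem theorem5p4 (R : realType) (A : ainf_algebra R[i]) :
  exists M C : ainf_algebra R[i],
    minimal M /\ linear_contractible C /\ ainf_isomorphic A (dsum M C).
Proof. exact: ainf_decomposition. Qed.
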